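(* Let $\theta$ be an inner function and $g\in L^\infty(\mathbb{T})$, and assume that $\ker D_g^\theta$ is finite dimensional. Let $A=\{f\in\ker D_g^\theta : gf\in K_\theta\cap zH^2\}$ and $C=\ker D_g^\theta\cap(\overline{H^2_0}\oplus\theta zH^2)\cap A$. 1. If $\dim(\ker D_g^\theta\ominus C)=2$, then, with $f_0,h_0\in\ker D_g^\theta$ such that $gf_0,gh_0$ are orthonormal basis elements of $g\ker D_g^\theta\ominus gC$, there is a closed $S^*$-invariant subspace $K$ of $H^2(\mathbb{D},\mathbb{C}^2)$ with $$\ker D_g^\theta=\left\{\begin{pmatrix}f_0&h_0\end{pmatrix}\begin{pmatrix}k_0\\k_1\end{pmatrix} : \begin{pmatrix}k_0\\k_1\end{pmatrix}\in K\right\}.$$ 2. If $\dim(\ker D_g^\theta\ominus C)=1$, then, with $f_0\in\ker D_g^\theta$ such that $gf_0$ is a normalised element of $g\ker D_g^\theta\ominus gC$, there is an inner function $\chi$ with $$\ker D_g^\theta=f_0K_{\chi z}.$$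
   Context: $H^2$ is the Hardy space of the unit disc $\mathbb{D}$, identified with its boundary functions in $L^2=L^2(\mathbb{T})$, and $H^2(\mathbb{D},\mathbb{C}^2)$ is the space of column vectors of length 2 with entries in $H^2$. $\overline{H^2_0}=\{\overline f : f\in H^2,f(0)=0\}$. For an inner function $I$, $K_I=I\overline{H^2_0}\cap H^2$. In $L^2$, $K_\theta^\perp=\overline{H^2_0}\oplus\theta H^2$; let $Q$ be the orthogonal projection of $L^2$ onto $K_\theta^\perp$. The dual truncated Toeplitz operator $D_g^\theta:K_\theta^\perp\to K_\theta^\perp$ is $D_g^\theta f=Q(gf)$ (so $gf\in K_\theta$ for $f\in\ker D_g^\theta$). $gX=\{gf:f\in X\}$. The backward shift is $S^*F(z)=(F(z)-F(0))/z$ (entrywise). *)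

(* Defs.v *)
From HB Require Import structures.
From mathcomp Require Import all_boot all_order all_algebra.
From mathcomp Require Import complex.
From mathcomp Require Import all_classical all_reals all_analysis.

Set Implicit Arguments.
Unset Strict Implicit.
Unset Printing Implicit Defensive.
Import Order.TTheory GRing.Theory Num.Theory.
Import numFieldNormedType.Exports.

Local Open Scope classical_set_scope.
Local Open Scope complex_scope.
Local Open Scope ring_scope.

(* A function on the unit circle is represented by [f : R -> R[i]], where [f t]
   is its value at e^(it); only the values on [0, 2 pi] matter. Elements of L^2
   are given by measurable representatives, identified up to
   [f = g %[ae arcm]]: the sets of functions below are closed under a.e.
   equality between measurable functions, so that an equality of such sets is
   an equality of sets of classes. *)

Lemma twopi_gt0 (R : realType) : 0 < 2 * pi :> R.
Proof. by rewrite mulr_gt0 ?pi_gt0. Qed.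

Section DualTruncatedToeplitz.
Variable R : realType.
Implicit Types (theta g u : R -> R[i]) (X Y : set (R -> R[i])).

(* normalised arc length: the measure dt / (2 pi) on [0, 2 pi] *)
Definition arcm : probability (measurableTypeR R) R :=
  uniform_prob (twopi_gt0 R).

Definition cmeasurable (f : R -> R[i]) : Prop :=
  measurable_fun [set: measurableTypeR R] (@complex.Re R \o f) /\
  measurable_fun [set: measurableTypeR R] (@complex.Im R \o f).

Definition Lp (p : \bar R) : set (R -> R[i]) :=
  [set f : R -> R[i] |
    (@complex.Re R \o f : measurableTypeR R -> R) \in Lfun arcm p /\
    (@complex.Im R \o f : measurableTypeR R -> R) \in Lfun arcm p].

Definition L2 : set (R -> R[i]) := Lp 2%:E.
Definition Linfty : set (R -> R[i]) := Lp +oo%E.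

Definition cintegral (f : R -> R[i]) : R[i] :=
  (\int[arcm]_t complex.Re (f t)) +i* (\int[arcm]_t complex.Im (f t)).

Definition conjf (f : R -> R[i]) : R -> R[i] := fun t => (f t)^*.

Definition ip (f h : R -> R[i]) : R[i] := cintegral (f \* conjf h).

Definition sqnorm (f : R -> R[i]) : R := complex.Re (ip f f).

Definition zT : R -> R[i] := fun t => cos t +i* sin t.

Definition fourier (f : R -> R[i]) (n : int) : R[i] :=
  ip f (fun t => zT t ^ n).

(* The Hardy space, as the space of its boundary functions: a function of L^2
   with Fourier series sum_(n >= 0) a_n z^n is the boundary function of the
   element F(z) = sum_(n >= 0) a_n z^n of the Hardy space of the disc. In
   particular F(0) is the Fourier coefficient of index 0. *)
Definition H2 : set (R -> R[i]) :=
  [set f | L2 f /\ forall n : nat, fourier f (- n.+1%:Z) = 0].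

Definition at0 (f : R -> R[i]) : R[i] := fourier f 0.

Definition conjH20 : set (R -> R[i]) := conjf @` [set f | H2 f /\ at0 f = 0].

Definition inner_function (I : R -> R[i]) : Prop :=
  H2 I /\ (fun t => `|I t|) = cst 1 %[ae arcm].

Definition mulset u X : set (R -> R[i]) :=
  [set f | cmeasurable f /\ exists2 x, X x & f = u \* x %[ae arcm]].

Definition sumset X Y : set (R -> R[i]) :=
  [set f | cmeasurable f /\
    exists x y, [/\ X x, Y y & f = x \+ y %[ae arcm]]].

Definition modelspace (I : R -> R[i]) : set (R -> R[i]) :=
  mulset I conjH20 `&` H2.

Definition ominus X Y : set (R -> R[i]) :=
  [set f | X f /\ forall y, Y y -> ip f y = 0].

Definition modelperp theta : set (R -> R[i]) := ominus L2 (modelspace theta).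

(* [q] is the orthogonal projection of [u] on [X] *)
Definition orthproj X u (q : R -> R[i]) : Prop :=
  X q /\ forall x, X x -> ip (u \- q) x = 0.

(* the graph of the operator: [f] is in its domain and is mapped to [q] *)
Definition dualtto theta g (f q : R -> R[i]) : Prop :=
  modelperp theta f /\ orthproj (modelperp theta) (g \* f) q.

Definition kerdualtto theta g : set (R -> R[i]) :=
  [set f | dualtto theta g f (cst 0)].

Definition spaceA theta g : set (R -> R[i]) :=
  [set f | kerdualtto theta g f /\
           (modelspace theta `&` mulset zT H2) (g \* f)].

Definition spaceC theta g : set (R -> R[i]) :=
  kerdualtto theta g `&` sumset conjH20 (mulset (theta \* zT) H2)
    `&` spaceA theta g.

Definition lincomb n (c : 'I_n -> R[i]) (e : 'I_n -> R -> R[i]) : R -> R[i] :=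
  fun t => \sum_i c i * e i t.

Definition spanned X n (e : 'I_n -> R -> R[i]) : Prop :=
  (forall i, X (e i)) /\
  forall x, X x -> exists c, x = lincomb c e %[ae arcm].

Definition hasdim X n : Prop :=
  exists2 e : 'I_n -> R -> R[i], spanned X e &
    forall c, lincomb c e = cst 0 %[ae arcm] -> forall i, c i = 0.

Definition finitedim X : Prop := exists n, hasdim X n.

Definition orthonormal_basis X n (e : 'I_n -> R -> R[i]) : Prop :=
  spanned X e /\ forall i j, ip (e i) (e j) = (i == j)%:R.

Definition bshift (F : R -> R[i]) : R -> R[i] :=
  fun t => (F t - at0 F) / zT t.

(* closed S^*-invariant linear subspaces of H^2(D, C^2), an element of which
   is given by the pair of its entries *)
Definition closed_bshift_invariant (K : set ((R -> R[i]) * (R -> R[i]))) :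
    Prop :=
  [/\ K `<=` H2 `*` H2,
      K (cst 0, cst 0) /\
      (forall (a : R[i]) x y, K x -> K y ->
        K (cst a \* x.1 \+ y.1, cst a \* x.2 \+ y.2)),
      (forall x, (H2 `*` H2) x ->
        (forall e : R, 0 < e -> exists2 y, K y &
          sqnorm (x.1 \- y.1) + sqnorm (x.2 \- y.2) < e) ->
        K x) &
      forall x, K x -> K (bshift x.1, bshift x.2)].

End DualTruncatedToeplitz.

(* Main.v *)
Require Import Defs.
From HB Require Import structures.
From mathcomp Require Import all_boot all_order all_algebra.
From mathcomp Require Import complex.
From mathcomp Require Import all_classical all_reals all_analysis.
From mathcomp Require Import measurable_realfun ess_sup_inf ring lra zify.

(** Write N for the kernel and C for its subspace in the statement. Every
    f in C is such that zbar f still belongs to N: its component in theta H^2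
    has a factor theta z, and g f lies both in the model space and in z H^2
    (C_shift). This is near invariance of N under the backward shift, and the
    proof is the algorithm of Hitt, which finite dimension turns into linear
    algebra.

    Let u_1, ..., u_m (m = 1 or 2) be elements of N such that the g u_p are
    orthonormal and orthogonal to g C, where m is the dimension of the orthogonal
    complement of C in N (C is denoted by D below). A dependence relation
    between the components orthogonal to C of an f in N and of the u_p shows
    that f = sum_p a_p u_p + c with c in C (ker_decomp).
    Applied to a basis e of N, with zbar c expanded in the basis again, this
    gives a matrix M and coefficients alpha such that, almost everywhere,
      e = alpha u + z M e                                      (ker_system).
    An eigenvalue l of M has modulus less than 1 (eigenvalue_lt1): the
    corresponding f = sum_p a_p u_p + l z f satisfies
      ||g f||^2 = sum_p |a_p|^2 + |l|^2 ||g f||^2,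
    so |l| >= 1 forces f = l z f, hence f = 0 as z takes the value 1/l on a
    null set only. The system can therefore be solved: e = (1 - z M)^-1 alpha u,
    where the entries of the transfer function (1 - z M)^-1 alpha are rational
    functions with no pole in the closed disc, thus elements of H^2
    (H2_transfer).

    For m = 2, the rows of the transfer function span a finite-dimensional,
    hence closed, space K of pairs. It is invariant under the backward shift,
    because k = alpha + z M k means that S^* k = M k
    (transfer_space_invariant).

    For m = 1, the elements of N are the f0 p / q with q = det (1 - z M) and p
    in an n-dimensional space of polynomials of degree less than n = dim N,
    that is, all of them. Since f0 is in N, q is itself such a numerator, so
    that its degree is less than n. The functions p / q then form the model
    space of z chi with chi = z^(n-1) conj q / q (modelspace_rational).

    On the analytic side all this rests on two facts on L^2 of the circle: a
    function whose Fourier coefficients vanish is null (fourier_inj), and H^2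
    is orthogonal to the conjugate of H^2_0 (H2_ortho). Both come from the
    density of the trigonometric polynomials (trig_dense). Bounded functions
    in their closure form an algebra; the iterates of x -> (3 x - x^3) / 2
    converge to the sign of x, so the closure contains the indicator functions
    of the sets where the cosine is greater than a constant and where the sine
    is positive or negative, hence those of intervals, then of Borel sets, and
    finally all of L^2. *)

Set Implicit Arguments.
Unset Strict Implicit.
Unset Printing Implicit Defensive.
Import Order.TTheory GRing.Theory Num.Theory.
Import numFieldNormedType.Exports.

Local Open Scope classical_set_scope.
Local Open Scope complex_scope.
Local Open Scope ring_scope.

(** * Integration against normalised arc length *)

Section SquareIntegrable.
Variable R : realType.
Local Notation C := R[i].
Local Notation mu := (arcm R).
Implicit Types (f g h : R -> C) (a b : C) (u v : R -> R).

#[global] Instance ae_arcm_filter : Filter (almost_everywhere mu).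
Proof. exact: ae_filter_ringOfSetsType. Qed.

Definition rintegrable u := mu.-integrable setT (EFin \o u).

Lemma rintegrable_meas u : rintegrable u ->
  measurable_fun [set: measurableTypeR R] u.
Proof. by move=> /measurable_int /measurable_EFinP. Qed.

Lemma rintegrableD u v : rintegrable u -> rintegrable v -> rintegrable (u \+ v).
Proof. by move=> iu iv; apply: eq_integrable (integrableD _ iu iv). Qed.

Lemma rintegrableZ (r : R) u : rintegrable u -> rintegrable (fun t => r * u t).
Proof. by move=> iu; apply: eq_integrable (integrableZl _ r iu). Qed.

Lemma rintegrableB u v : rintegrable u -> rintegrable v -> rintegrable (u \- v).
Proof. by move=> iu iv; apply: eq_integrable (integrableB _ iu iv). Qed.

Lemma le_rintegrable u v : measurable_fun [set: measurableTypeR R] u ->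
  rintegrable v -> (\forall t \ae mu, `|u t| <= v t) -> rintegrable u.
Proof.
move=> mu_ iv uv; apply/integrableP; split; first exact/measurable_EFinP.
apply: le_lt_trans (_ : (\int[mu]_t `|(v t)%:E| < +oo)%E); last first.
  by case/integrableP: iv.
apply: ae_ge0_le_integral => //.
- exact/measurableT_comp/measurable_EFinP.
- by apply/measurableT_comp => //; exact: measurable_int iv.
- apply: filterS uv => t uv _ /=; rewrite lee_fin.
  by rewrite (le_trans uv)// ler_norm.
Qed.

Lemma Rintegral_ae u v : measurable_fun [set: measurableTypeR R] u ->
  measurable_fun [set: measurableTypeR R] v ->
  (\forall t \ae mu, u t = v t) -> \int[mu]_t u t = \int[mu]_t v t.
Proof.
move=> mu_ mv uv; congr fine; apply: ae_eq_integral => //.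
- exact/measurable_EFinP.
- exact/measurable_EFinP.
- by apply: filterS uv => t -> _.
Qed.

(** The positive part of v - u is integrated instead of v - u: it is
    nonnegative everywhere, not only almost everywhere. *)
Lemma le_Rintegral u v : rintegrable u -> rintegrable v ->
  (\forall t \ae mu, u t <= v t) -> \int[mu]_t u t <= \int[mu]_t v t.
Proof.
move=> iu iv uv; rewrite -subr_ge0 -RintegralB//.
pose w := fun t => Num.max 0 (v t - u t).
have mB := rintegrable_meas (rintegrableB iv iu).
have -> : \int[mu]_t (v t - u t) = \int[mu]_t w t.
  apply: Rintegral_ae => //; first exact: measurable_maxr.
  by apply: filterS uv => t uv; rewrite /w max_r// subr_ge0.
by apply: Rintegral_ge0 => t _; rewrite /w le_max lexx.
Qed.

Lemma Rintegral_eq0 u : rintegrable u -> (forall t, 0 <= u t) ->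
  \int[mu]_t u t = 0 -> \forall t \ae mu, u t = 0.
Proof.
move=> iu u0 /eqP; rewrite /Rintegral fine_eq0; last exact: integrable_fin_num.
move=> /eqP int0.
have : (\int[mu]_t `|(u t)%:E| = 0)%E.
  by rewrite -[RHS]int0; apply: eq_integral => t _; rewrite gee0_abs ?lee_fin.
move=> /(ae_eq_integral_abs mu measurableT (measurable_int _ iu)).
by apply: filterS => t /(_ I) [].
Qed.

Lemma Rintegral_cst (r : R) : \int[mu]_t r = r.
Proof.
rewrite /Rintegral integral_cst//.
by rewrite [X in (_ * X)%E](@probability_setT _ _ _ mu) mule1.
Qed.

Lemma rintegrable_cst (r : R) : rintegrable (cst r).
Proof. exact: finite_measure_integrable_cst. Qed.

(** * Square-integrable functions *)

Lemma Lfun2P u : (u : measurableTypeR R -> R) \in Lfun mu 2%:E <->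
  measurable_fun [set: measurableTypeR R] u /\ rintegrable (fun t => u t ^+ 2).
Proof.
split=> [u2|[mu_ iu]].
  split; last exact: Lfun2_integrable_sqr.
  by move: u2; rewrite inE => /andP[+ _]; rewrite inE.
rewrite inE; apply/andP; split; rewrite inE//=.
rewrite /finite_norm unlock poweR_lty//.
case/integrableP: iu => _; apply: le_lt_trans.
rewrite le_eqVlt; apply/orP; left; apply/eqP; apply: eq_integral => t _ /=.
by rewrite powR_mulrn// -normrX.
Qed.

(** The squared modulus with values in R, where integrals take their values;
    the norm of R[i] takes its values in R[i]. *)
Definition nsq (z : C) : R := complex.Re z ^+ 2 + complex.Im z ^+ 2.

Lemma nsq_ge0 z : 0 <= nsq z.
Proof. by rewrite addr_ge0 ?sqr_ge0. Qed.

Lemma nsq_eq0 z : nsq z = 0 -> z = 0.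
Proof.
case: z => x y; rewrite /nsq /= => /eqP.
by rewrite paddr_eq0 ?sqr_ge0// !sqrf_eq0 => /andP[/eqP-> /eqP->].
Qed.

Lemma nsq0 : nsq 0 = 0. Proof. by rewrite /nsq /= expr0n addr0. Qed.

Lemma nsq1 : nsq 1 = 1. Proof. by rewrite /nsq /= expr1n expr0n addr0. Qed.

Lemma nsqM (z w : C) : nsq (z * w) = nsq z * nsq w.
Proof. by case: z => a b; case: w => c d; rewrite /nsq /=; ring. Qed.

Lemma nsqJ (z : C) : nsq z^* = nsq z.
Proof. by case: z => a b; rewrite /nsq /= sqrrN. Qed.

Lemma nsqD_le (z w : C) : nsq (z + w) <= 2 * nsq z + 2 * nsq w.
Proof.
case: z => a b; case: w => c d; rewrite /nsq /=.
have := sqr_ge0 (a - c); have := sqr_ge0 (b - d); nra.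
Qed.

Lemma nsq_norm (z : C) : (nsq z)%:C = `|z| ^+ 2.
Proof. exact: add_Re2_Im2. Qed.

Lemma mulcJ (z : C) : z * z^* = (nsq z)%:C.
Proof. by rewrite nsq_norm sqr_normc. Qed.

Lemma le_ReM (z w : C) : `|complex.Re (z * w)| <= nsq z + nsq w.
Proof.
case: z => a b; case: w => c d; rewrite /nsq /= ler_norml.
have := sqr_ge0 (a - c); have := sqr_ge0 (a + c).
have := sqr_ge0 (b - d); have := sqr_ge0 (b + d).
have := sqr_ge0 a; have := sqr_ge0 b; have := sqr_ge0 c; have := sqr_ge0 d.
by move=> *; apply/andP; split; nra.
Qed.

Lemma le_ImM (z w : C) : `|complex.Im (z * w)| <= nsq z + nsq w.
Proof.
have -> : complex.Im (z * w) = complex.Re (- 'i * z * w).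
  by case: z => a b; case: w => c d /=; ring.
apply: le_trans (le_ReM _ _) _; rewrite nsqM.
by rewrite (_ : nsq (- 'i) = 1) ?mul1r// /nsq /=; ring.
Qed.

Lemma cmeasurableD f g :
  cmeasurable f -> cmeasurable g -> cmeasurable (f \+ g).
Proof.
move=> [rf jf] [rg jg]; split.
- rewrite (_ : _ \o _ = (@complex.Re R \o f) \+ (@complex.Re R \o g)).
    exact: measurable_funD.
  by apply/funext => t /=; case: (f t); case: (g t).
- rewrite (_ : _ \o _ = (@complex.Im R \o f) \+ (@complex.Im R \o g)).
    exact: measurable_funD.
  by apply/funext => t /=; case: (f t); case: (g t).
Qed.

Lemma cmeasurableM f g :
  cmeasurable f -> cmeasurable g -> cmeasurable (f \* g).
Proof.
move=> [rf jf] [rg jg]; split.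
- rewrite (_ : _ \o _ = ((@complex.Re R \o f) \* (@complex.Re R \o g)) \-
     ((@complex.Im R \o f) \* (@complex.Im R \o g))).
    by apply: measurable_funB; exact: measurable_funM.
  by apply/funext => t /=; case: (f t); case: (g t).
- rewrite (_ : _ \o _ = ((@complex.Re R \o f) \* (@complex.Im R \o g)) \+
     ((@complex.Im R \o f) \* (@complex.Re R \o g))).
    by apply: measurable_funD; exact: measurable_funM.
  by apply/funext => t /=; case: (f t); case: (g t).
Qed.

Lemma cmeasurable_cst a : cmeasurable (cst a : R -> C).
Proof. by split; exact: measurable_cst. Qed.

Lemma cmeasurable_conj f : cmeasurable f -> cmeasurable (conjf f).
Proof.
move=> [rf jf]; split.
- rewrite (_ : _ \o _ = (@complex.Re R \o f))//.
  by apply/funext => t /=; rewrite /conjf; case: (f t).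
- rewrite (_ : _ \o _ = \- (@complex.Im R \o f)); first exact: measurable_funN.
  by apply/funext => t /=; rewrite /conjf; case: (f t).
Qed.

Lemma cmeasurable_nsq f : cmeasurable f ->
  measurable_fun [set: measurableTypeR R] (fun t => nsq (f t)).
Proof.
move=> [rf jf].
rewrite (_ : (fun t => _) = (fun t => (@complex.Re R \o f) t ^+ 2) \+
  (fun t => (@complex.Im R \o f) t ^+ 2))//.
by apply: measurable_funD; exact: measurable_funX.
Qed.

Lemma L2P f : L2 f <-> cmeasurable f /\ rintegrable (fun t => nsq (f t)).
Proof.
split=> [[/Lfun2P[rf irf] /Lfun2P[jf ijf]]|[[rf jf] iff]].
  split=> //; exact: rintegrableD irf ijf.
have mf : cmeasurable f by [].
split; apply/Lfun2P; split => //.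
- apply: (le_rintegrable _ iff); first exact: measurable_funX.
  by apply: aeW => t /=; rewrite ger0_norm ?sqr_ge0// lerDl sqr_ge0.
- apply: (le_rintegrable _ iff); first exact: measurable_funX.
  by apply: aeW => t /=; rewrite ger0_norm ?sqr_ge0// lerDr sqr_ge0.
Qed.

Lemma L2_meas f : L2 f -> cmeasurable f.
Proof. by case/L2P. Qed.

(** The relation of the %[ae _] notation without its premise in setT. *)
Definition aeq f g := \forall t \ae mu, f t = g t.

Lemma aeqP f g : f = g %[ae mu] <-> aeq f g.
Proof.
by split; apply: filterS => t; [move/(_ I)|move=> fg _].
Qed.

Lemma aeq_refl f : aeq f f. Proof. exact: aeW. Qed.

Lemma aeq_sym f g : aeq f g -> aeq g f.
Proof. by apply: filterS => t ->. Qed.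

Lemma aeq_trans f g h : aeq f g -> aeq g h -> aeq f h.
Proof. by apply: filterS2 => t -> ->. Qed.

Lemma aeqM f f' g g' : aeq f f' -> aeq g g' -> aeq (f \* g) (f' \* g').
Proof. by apply: filterS2 => t /= -> ->. Qed.

Lemma aeq_conj f f' : aeq f f' -> aeq (conjf f) (conjf f').
Proof. by apply: filterS => t /=; rewrite /conjf => ->. Qed.

Lemma L2_aeq f g : cmeasurable g -> aeq f g -> L2 f -> L2 g.
Proof.
move=> mg fg /L2P[mf iff]; apply/L2P; split=> //.
apply: (le_rintegrable _ iff); first exact: cmeasurable_nsq.
by apply: filterS fg => t ->; rewrite ger0_norm ?nsq_ge0.
Qed.

Lemma L2D f g : L2 f -> L2 g -> L2 (f \+ g).
Proof.
move=> /L2P[mf iff] /L2P[mg ig]; apply/L2P; split; first exact: cmeasurableD.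
apply: (le_rintegrable _ (rintegrableD (rintegrableZ 2 iff) (rintegrableZ 2 ig))).
  by apply: cmeasurable_nsq; exact: cmeasurableD.
by apply: aeW => t /=; rewrite ger0_norm ?nsq_ge0//; exact: nsqD_le.
Qed.

Definition ebounded g :=
  cmeasurable g /\ exists M, \forall t \ae mu, nsq (g t) <= M.

Lemma L2M g f : ebounded g -> L2 f -> L2 (g \* f).
Proof.
move=> [mg [M gM]] /L2P[mf iff]; apply/L2P; split; first exact: cmeasurableM.
apply: (le_rintegrable _ (rintegrableZ M iff)).
  by apply: cmeasurable_nsq; exact: cmeasurableM.
apply: filterS gM => t gM /=; rewrite ger0_norm ?nsq_ge0// nsqM.
by rewrite ler_wpM2r ?nsq_ge0.
Qed.

Lemma ebounded_cst a : ebounded (cst a).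
Proof.
by split; [exact: cmeasurable_cst|exists (nsq a); exact: aeW].
Qed.

Lemma eboundedM f g : ebounded f -> ebounded g -> ebounded (f \* g).
Proof.
move=> [mf [M fM]] [mg [N gN]]; split; first exact: cmeasurableM.
exists (M * N); apply: filterS2 fM gN => t fM gN /=.
by rewrite nsqM ler_pM ?nsq_ge0.
Qed.

Lemma eboundedD f g : ebounded f -> ebounded g -> ebounded (f \+ g).
Proof.
move=> [mf [M fM]] [mg [N gN]]; split; first exact: cmeasurableD.
exists (2 * M + 2 * N); apply: filterS2 fM gN => t fM gN /=.
by apply: le_trans (nsqD_le _ _) _; rewrite lerD// ler_pM2l.
Qed.

Lemma ebounded_L2 f : ebounded f -> L2 f.
Proof.
move=> [mf [M fM]]; apply/L2P; split=> //.
apply: (le_rintegrable (cmeasurable_nsq mf) (rintegrable_cst M)).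
by apply: filterS fM => t fM; rewrite ger0_norm ?nsq_ge0.
Qed.

Lemma Linfty_ebounded g : Linfty g -> ebounded g.
Proof.
have Lb u : (u : measurableTypeR R -> R) \in Lfun mu +oo%E ->
    measurable_fun [set: measurableTypeR R] u /\
    exists M, \forall t \ae mu, `|u t| <= M.
  rewrite inE => /andP[]; rewrite !inE /= => mu_ fu; split=> //.
  move: fu; rewrite /finite_norm unlock /Lnorm.
  rewrite [X in (0 < X)%E](@probability_setT _ _ _ mu) lte01.
  by move=> /ess_supr_bounded[M uM]; exists M.
case=> /Lb[rg [M gM]] /Lb[jg [N gN]]; split=> //.
exists (M ^+ 2 + N ^+ 2); apply: filterS2 gM gN => t /= gM gN.
have sqle (x y : R) : `|x| <= y -> x ^+ 2 <= y ^+ 2.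
  by move=> xy; rewrite -[x ^+ 2]real_normK ?num_real// ler_pXn2r// nnegrE ?normr_ge0// (le_trans _ xy).
by rewrite lerD// sqle.
Qed.

Lemma L2Z a f : L2 f -> L2 (cst a \* f).
Proof. exact/L2M/ebounded_cst. Qed.

Lemma L2_cst a : L2 (cst a). Proof. exact/ebounded_L2/ebounded_cst. Qed.

Lemma L2J f : L2 f -> L2 (conjf f).
Proof.
move=> /L2P[mf iff]; apply/L2P; split; first exact: cmeasurable_conj.
by rewrite (_ : (fun t => _) = (fun t => nsq (f t)))//; apply/funext => t; rewrite /conjf nsqJ.
Qed.

Lemma L2B f g : L2 f -> L2 g -> L2 (f \- g).
Proof.
move=> f2 /(L2Z (-1)) g2; rewrite (_ : f \- g = f \+ (cst (-1) \* g)).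
  exact: L2D.
by apply/funext => t /=; rewrite mulN1r.
Qed.

Lemma L2_lincomb n (c : 'I_n -> C) e : (forall i, L2 (e i)) -> L2 (lincomb c e).
Proof.
move=> e2; rewrite (_ : lincomb c e = \sum_i (cst (c i) \* e i)).
  apply: big_ind => [|f g|i _]; [exact: L2_cst|exact: L2D|exact: L2Z].
by apply/funext => t; rewrite /lincomb fct_sumE.
Qed.

(** * The inner product of L^2 *)

Definition cintegrable f :=
  rintegrable (@complex.Re R \o f) /\ rintegrable (@complex.Im R \o f).

Lemma L2_cintegrableM f g : L2 f -> L2 g -> cintegrable (f \* g).
Proof.
move=> /L2P[mf iff] /L2P[mg ig]; have [rfg jfg] := cmeasurableM mf mg.
split; apply: (le_rintegrable _ (rintegrableD iff ig)) => //; apply: aeW => t /=.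
- exact: le_ReM.
- exact: le_ImM.
Qed.

Lemma cintegralD f g : cintegrable f -> cintegrable g ->
  cintegral (f \+ g) = cintegral f + cintegral g.
Proof.
move=> [rf jf] [rg jg]; rewrite /cintegral.
rewrite [RHS](_ : _ = (\int[mu]_t complex.Re (f t) + \int[mu]_t complex.Re (g t))
   +i* (\int[mu]_t complex.Im (f t) + \int[mu]_t complex.Im (g t)))//.
rewrite -!RintegralD//; congr Complex; apply: eq_Rintegral => t _ /=.
- by case: (f t); case: (g t).
- by case: (f t); case: (g t).
Qed.

Lemma cintegralZ a f : cintegrable f ->
  cintegral (cst a \* f) = a * cintegral f.
Proof.
move=> [rf jf]; rewrite /cintegral; case: a => x y /=.
have E : (\int[mu]_t complex.Re (f t) +i* \int[mu]_t complex.Im (f t)) =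
 (\int[mu]_t complex.Re (f t)) +i* (\int[mu]_t complex.Im (f t)) by [].
rewrite [RHS](_ : _ =
  (x * \int[mu]_t complex.Re (f t) - y * \int[mu]_t complex.Im (f t))
   +i* (x * \int[mu]_t complex.Im (f t) + y * \int[mu]_t complex.Re (f t)))//.
rewrite -!RintegralZl// -RintegralB// -?RintegralD//; try exact: rintegrableZ.
by congr Complex; apply: eq_Rintegral => t _ /=; case: (f t).
Qed.

Lemma cintegralJ f : cintegrable f -> cintegral (conjf f) = (cintegral f)^*.
Proof.
move=> [rf jf]; rewrite /cintegral /=; congr Complex.
- by apply: eq_Rintegral => t _; rewrite /conjf; case: (f t).
- rewrite -mulN1r -RintegralZl//; apply: eq_Rintegral => t _.
  by rewrite /conjf; case: (f t) => p q /=; rewrite mulN1r.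
Qed.

Lemma cintegral_aeq f g : cmeasurable f -> cmeasurable g -> aeq f g ->
  cintegral f = cintegral g.
Proof.
move=> [rf jf] [rg jg] fg; rewrite /cintegral; congr Complex.
- by apply: Rintegral_ae => //; apply: filterS fg => t ->.
- by apply: Rintegral_ae => //; apply: filterS fg => t ->.
Qed.

Lemma ipDl f g h : L2 f -> L2 g -> L2 h -> ip (f \+ g) h = ip f h + ip g h.
Proof.
move=> f2 g2 h2; rewrite /ip.
rewrite -cintegralD; try exact/L2_cintegrableM/L2J.
by congr cintegral; apply/funext => t /=; rewrite mulrDl.
Qed.

Lemma ipZl a f h : L2 f -> L2 h -> ip (cst a \* f) h = a * ip f h.
Proof.
move=> f2 h2; rewrite /ip -cintegralZ; last exact/L2_cintegrableM/L2J.
by congr cintegral; apply/funext => t /=; rewrite mulrA.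
Qed.

Lemma ipC f h : L2 f -> L2 h -> ip f h = (ip h f)^*.
Proof.
move=> f2 h2; rewrite /ip -cintegralJ; last exact/L2_cintegrableM/L2J.
congr cintegral; apply/funext => t /=.
by rewrite /conjf rmorphM /= [X in _ = _ * X]conjCK mulrC.
Qed.

Lemma ip_aeq f f' h h' : L2 f -> L2 h -> L2 f' -> L2 h' ->
  aeq f f' -> aeq h h' -> ip f h = ip f' h'.
Proof.
move=> f2 h2 f2' h2' ff hh; apply: cintegral_aeq.
- exact/cmeasurableM/cmeasurable_conj/L2_meas/h2/L2_meas.
- exact/cmeasurableM/cmeasurable_conj/L2_meas/h2'/L2_meas.
- exact/aeqM/aeq_conj.
Qed.

Lemma ipDr f g h : L2 f -> L2 g -> L2 h -> ip h (f \+ g) = ip h f + ip h g.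
Proof.
move=> f2 g2 h2; rewrite ipC//; last exact: L2D.
by rewrite ipDl// rmorphD /= -!ipC.
Qed.

Lemma ipZr a f h : L2 f -> L2 h -> ip h (cst a \* f) = a^* * ip h f.
Proof.
move=> f2 h2; rewrite ipC//; last exact: L2Z.
by rewrite ipZl// rmorphM /= -ipC.
Qed.

Lemma ip0l h : L2 h -> ip (cst 0) h = 0.
Proof.
move=> h2; rewrite (_ : cst 0 = cst (0 : C) \* cst (0 : C)); last first.
  by apply/funext => t /=; rewrite mul0r.
by rewrite ipZl ?mul0r//; exact: L2_cst.
Qed.

Lemma ip0r h : L2 h -> ip h (cst 0) = 0.
Proof. by move=> h2; rewrite ipC ?ip0l ?conjC0//; apply: L2_cst. Qed.

Lemma ipBl f g h : L2 f -> L2 g -> L2 h -> ip (f \- g) h = ip f h - ip g h.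
Proof.
move=> f2 g2 h2; rewrite (_ : f \- g = f \+ (cst (-1) \* g)).
  by rewrite ipDl// ?ipZl ?mulN1r//; exact: L2Z.
by apply/funext => t /=; rewrite mulN1r.
Qed.

Lemma ip_lincombl n (c : 'I_n -> C) e h : (forall i, L2 (e i)) -> L2 h ->
  ip (lincomb c e) h = \sum_i c i * ip (e i) h.
Proof.
move=> e2 h2; rewrite (_ : lincomb c e = \sum_i (cst (c i) \* e i)); last first.
  by apply/funext => t; rewrite /lincomb fct_sumE.
suff [] : L2 (\sum_i (cst (c i) \* e i)) /\
   ip (\sum_i (cst (c i) \* e i)) h = \sum_i c i * ip (e i) h by [].
elim/big_ind2 : _ => [|f x g y [f2 <-] [g2 <-]|i _].
- by split; [exact: L2_cst|exact: ip0l].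
- by split; [exact: L2D|exact: ipDl].
- by split; [exact: L2Z|rewrite ipZl].
Qed.

Lemma sqnormE f : sqnorm f = \int[mu]_t nsq (f t).
Proof. by apply: eq_Rintegral => t _; rewrite /= /conjf mulcJ. Qed.

Lemma ipff f : ip f f = (sqnorm f)%:C.
Proof.
rewrite /ip sqnormE /cintegral -[RHS]complexr0; congr Complex.
  by apply: eq_Rintegral => t _; rewrite /= /conjf mulcJ.
rewrite -[RHS](Rintegral_cst 0); apply: eq_Rintegral => t _.
by rewrite /= /conjf mulcJ.
Qed.

Lemma sqnorm_ge0 f : 0 <= sqnorm f.
Proof. by rewrite sqnormE; apply: Rintegral_ge0 => t _; exact: nsq_ge0. Qed.

Lemma sqnorm_eq0 f : L2 f -> sqnorm f = 0 -> aeq f (cst 0).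
Proof.
move=> /L2P[_ iff]; rewrite sqnormE => /(Rintegral_eq0 iff (fun=> nsq_ge0 _)).
by apply: filterS => t /nsq_eq0.
Qed.

Lemma sqnorm0 f : aeq f (cst 0) -> L2 f -> sqnorm f = 0.
Proof.
move=> f0 f2; rewrite /sqnorm (ip_aeq f2 f2 (L2_cst 0) (L2_cst 0))//.
by rewrite ip0l//; exact: L2_cst.
Qed.

Lemma sqnorm_aeq f g : L2 f -> L2 g -> aeq f g -> sqnorm f = sqnorm g.
Proof. by move=> f2 g2 fg; rewrite /sqnorm (ip_aeq f2 f2 g2 g2). Qed.

Lemma sqnormZ a f : L2 f -> sqnorm (cst a \* f) = nsq a * sqnorm f.
Proof.
move=> f2; apply: complexI; rewrite -ipff ipZl ?ipZr//; last exact: L2Z.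
by rewrite mulrA mulcJ ipff rmorphM.
Qed.

Lemma sqnormD f g : L2 f -> L2 g -> ip f g = 0 ->
  sqnorm (f \+ g) = sqnorm f + sqnorm g.
Proof.
move=> f2 g2 fg; apply: complexI; rewrite rmorphD /= -!ipff ipDl ?ipDr//; try exact: L2D.
by rewrite fg [ip g f]ipC// fg conjC0 addr0 add0r.
Qed.

Lemma sqnormD_le f g : L2 f -> L2 g ->
  sqnorm (f \+ g) <= 2 * sqnorm f + 2 * sqnorm g.
Proof.
move=> f2 g2; rewrite !sqnormE.
have [mf iff] := (L2P f).1 f2; have [mg ig] := (L2P g).1 g2.
rewrite -!RintegralZl// -RintegralD//; try exact: rintegrableZ.
apply: le_Rintegral; first by case/L2P: (L2D f2 g2).
- by apply: rintegrableD; exact: rintegrableZ.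
- by apply: aeW => t; exact: nsqD_le.
Qed.

Lemma sqnormN f : sqnorm (\- f) = sqnorm f.
Proof.
rewrite !sqnormE; apply: eq_Rintegral => t _.
by rewrite /= -mulN1r nsqM (_ : nsq (-1) = 1) ?mul1r// /nsq /=; ring.
Qed.

Lemma sqnorm_mul_le g f (M : R) : L2 f -> ebounded g ->
  (\forall t \ae mu, nsq (g t) <= M) -> sqnorm (g \* f) <= M * sqnorm f.
Proof.
move=> f2 bg gM; rewrite !sqnormE.
have [_ igf] := (L2P _).1 (L2M bg f2); have [mf iff] := (L2P f).1 f2.
rewrite -RintegralZl//; apply: le_Rintegral => //; first exact: rintegrableZ.
by apply: filterS gM => t gM /=; rewrite nsqM ler_wpM2r ?nsq_ge0.
Qed.

Lemma ip_small f g : L2 f -> L2 g -> sqnorm g = 0 -> ip f g = 0.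
Proof.
move=> f2 g2 /(sqnorm_eq0 g2) g0.
by rewrite (ip_aeq f2 g2 f2 (L2_cst 0) (aeq_refl f) g0) ip0r.
Qed.

End SquareIntegrable.

(** * The functions z^n and Fourier coefficients *)

Section TrigonometricSystem.
Variable R : realType.
Local Notation C := R[i].
Local Notation mu := (arcm R).
Implicit Types (f g h : R -> C) (a b : C) (u v : R -> R) (n m : int).

Definition zn n : R -> C := fun t => zT t ^ n.

Lemma nsq_zT t : nsq (zT t : C) = 1.
Proof. exact: cos2Dsin2. Qed.

Lemma zT_neq0 t : zT t != 0 :> C.
Proof.
by apply/eqP => z0; have := nsq_zT t; rewrite z0 /nsq /=; lra.
Qed.

Lemma zTJ t : (zT t)^* = (zT t)^-1 :> C.
Proof.
apply: (mulfI (zT_neq0 t)); rewrite divff ?zT_neq0//.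
by rewrite mulcJ nsq_zT.
Qed.

Lemma znD m n t : zn (m + n) t = zn m t * zn n t.
Proof. by rewrite /zn expfzDr// zT_neq0. Qed.

Lemma zn0 t : zn 0 t = 1. Proof. by rewrite /zn expr0z. Qed.

Lemma zn1 t : zn 1 t = zT t. Proof. by rewrite /zn expr1z. Qed.

Lemma znN n t : zn (- n) t = (zn n t)^*.
Proof. rewrite /zn -exprz_inv -zTJ; apply/esym; exact: fmorphXz. Qed.

Lemma nsq_zn n t : nsq (zn n t) = 1.
Proof.
by apply: complexI; rewrite -mulcJ -znN -znD subrr zn0.
Qed.

Lemma cmeasurable_zT : cmeasurable (@zT R).
Proof.
split; apply: continuous_measurable_fun.
- exact: continuous_cos.
- exact: continuous_sin.
Qed.

Lemma cmeasurable_zn n : cmeasurable (zn n).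
Proof.
have p (k : nat) : cmeasurable (zn k%:Z).
  elim: k => [|k ih].
    rewrite (_ : zn 0 = cst 1); first exact: cmeasurable_cst.
    by apply/funext => t; rewrite zn0.
  rewrite (_ : zn _ = @zT R \* zn k); first exact/cmeasurableM/ih/cmeasurable_zT.
  by apply/funext => t /=; rewrite intS znD zn1.
case: n => k; first exact: p.
rewrite NegzE (_ : zn _ = conjf (zn k.+1)); first exact/cmeasurable_conj/p.
by apply/funext => t; rewrite znN.
Qed.

Lemma ebounded_zn n : ebounded (zn n).
Proof.
by split; [exact: cmeasurable_zn|exists 1; apply: aeW => t; rewrite nsq_zn].
Qed.

Lemma ebounded_zT : ebounded (@zT R).
Proof.
rewrite (_ : @zT R = zn 1); first exact: ebounded_zn.
by apply/funext => t; rewrite zn1.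
Qed.

Lemma L2_zn n : L2 (zn n). Proof. exact/ebounded_L2/ebounded_zn. Qed.

Lemma de_Moivre (k : nat) (t : R) :
  zn k%:Z t = cos (k%:R * t) +i* sin (k%:R * t).
Proof.
elim: k => [|k ih]; first by rewrite zn0 mul0r cos0 sin0.
rewrite intS znD zn1 ih -natr1 mulrDl mul1r cosD sinD.
by congr Complex; ring.
Qed.

(** The integral for the uniform distribution is expressed by a Lebesgue
    integral for nonnegative functions only: 1 + f is one, with primitive
    t + F t. *)
Lemma arcm_integral_deriv (F f : R -> R) : (forall t, `|f t| <= 1) ->
  continuous f -> (forall t : R, is_derive t (1 : R) F (f t)) ->
  F (2 * pi) = F 0 -> \int[mu]_t f t = 0.
Proof.
move=> f1 cf dF F0.
have mf : measurable_fun [set: measurableTypeR R] f by exact: continuous_measurable_fun.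
have if_ : rintegrable f.
  apply: (le_rintegrable mf (rintegrable_cst 1)).
  by apply: aeW => t; exact: f1.
suff : \int[mu]_t (1 + f t) = 1.
  rewrite RintegralD//; last exact: rintegrable_cst.
  by rewrite Rintegral_cst => /eqP; rewrite addrC eq_sym -subr_eq subrr => /eqP.
have p0 : 0 < 2 * pi :> R by rewrite mulr_gt0 ?pi_gt0.
rewrite /Rintegral integral_uniform; last 2 first.
- by apply/measurable_EFinP; exact: measurable_funD.
- move=> t; rewrite lee_fin; have := f1 t; rewrite ler_norml => /andP[+ _].
  by lra.
have dG (t : R) : is_derive t (1 : R) (fun x => x + F x) (1 + f t).
  exact: is_deriveD.
have cG (t : R) : (fun x : R => x + F x) @ t --> t + F t.
  have dt : derivable (fun x : R => x + F x) t 1 by case: (dG t).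
  by have /derivable1_diffP/differentiable_continuous := dt.
rewrite (@continuous_FTC2 _ _ (fun t => t + F t))//.
- by rewrite F0 !add0r subr0 -EFinD addrK -EFinM /= mulVf// gt_eqF.
- apply: continuous_subspaceT => t; apply: cvgD; first exact: cvg_cst.
  exact: cf.
- split=> [t _||].
  + by case: (dG t).
  + exact: cvg_at_right_filter (cG 0).
  + exact: cvg_at_left_filter (cG _).
- move=> t _; rewrite derive1E; exact: derive_val.
Qed.

Lemma cintegral_zn n : cintegral (zn n) = (n == 0)%:R.
Proof.
have p (k : nat) : cintegral (zn k.+1%:Z) = 0.
  have k0 : k.+1%:R != 0 :> R by rewrite pnatr_eq0.
  have E1 : sin (k.+1%:R * (2 * pi)) = sin 0 :> R.
    by rewrite !mulr_natl -[X in sin X]add0r (periodicn (@sinD2pi R)).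
  have E2 : cos (k.+1%:R * (2 * pi)) = cos 0 :> R.
    by rewrite !mulr_natl -[X in cos X]add0r (periodicn (@cosD2pi R)).
  have dk (t : R) : is_derive t (1 : R) (fun x => k.+1%:R * x) k.+1%:R.
    by apply: is_derive_eq; rewrite [LHS]mulr1.
  have ck : continuous (fun x : R => k.+1%:R * x).
    by move=> t; apply: cvgM; [exact: cvg_cst|exact: cvg_id].
  rewrite /cintegral (_ : \int[mu]_t complex.Re _ = 0); last first.
    transitivity (\int[mu]_t cos (k.+1%:R * t)).
      by apply: eq_Rintegral => t _; rewrite de_Moivre.
    apply: (arcm_integral_deriv (F := fun t => k.+1%:R^-1 * sin (k.+1%:R * t))).
    - by move=> t; rewrite ler_norml cos_geN1 cos_le1.
    - by move=> t; apply: continuous_comp; [exact: ck|exact: continuous_cos].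
    - move=> t; have := is_derive1_comp (is_derive_sin (k.+1%:R * t)) (dk t).
      move=> /(is_deriveZ k.+1%:R^-1) d; apply: is_derive_eq d _.
      by rewrite /= [LHS](_ : _ = k.+1%:R^-1 * (cos (k.+1%:R * t) * k.+1%:R))//; field.
    - by rewrite E1 mulr0.
  rewrite (_ : \int[mu]_t complex.Im _ = 0)//.
  transitivity (\int[mu]_t sin (k.+1%:R * t)).
    by apply: eq_Rintegral => t _; rewrite de_Moivre.
  apply: (arcm_integral_deriv (F := fun t => - k.+1%:R^-1 * cos (k.+1%:R * t))).
  - by move=> t; rewrite ler_norml sin_geN1 sin_le1.
  - by move=> t; apply: continuous_comp; [exact: ck|exact: continuous_sin].
  - move=> t; have := is_derive1_comp (is_derive_cos (k.+1%:R * t)) (dk t).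
    move=> /(is_deriveZ (- k.+1%:R^-1)) d; apply: is_derive_eq d _.
    by rewrite /= [LHS](_ : _ = - k.+1%:R^-1 * (- sin (k.+1%:R * t) * k.+1%:R))//; field.
  - by rewrite E2 mulr0.
have i1 k : cintegrable (zn k).
  rewrite (_ : zn k = zn k \* cst 1).
    by apply: L2_cintegrableM; [exact: L2_zn|exact: L2_cst].
  by apply/funext => t /=; rewrite mulr1.
case: n => [[|k]|k].
- rewrite (_ : zn 0 = cst 1) /cintegral ?Rintegral_cst//.
- exact: p.
- rewrite NegzE (_ : zn _ = conjf (zn k.+1)); last first.
    by apply/funext => t; rewrite znN.
  by rewrite cintegralJ// p conjC0 oppr_eq0.
Qed.

Lemma ip_zn m n : ip (zn m) (zn n) = (m == n)%:R.
Proof.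
rewrite /ip (_ : _ \* _ = zn (m - n)); first by rewrite cintegral_zn subr_eq0.
by apply/funext => t; rewrite znD znN.
Qed.

Lemma fourier_zn m n : fourier (zn m) n = (m == n)%:R.
Proof. exact: ip_zn. Qed.

Lemma fourierD f g n : L2 f -> L2 g ->
  fourier (f \+ g) n = fourier f n + fourier g n.
Proof. by move=> f2 g2; rewrite /fourier ipDl//; exact: L2_zn. Qed.

Lemma fourierZ a f n : L2 f -> fourier (cst a \* f) n = a * fourier f n.
Proof. by move=> f2; rewrite /fourier ipZl//; exact: L2_zn. Qed.

Lemma fourierB f g n : L2 f -> L2 g ->
  fourier (f \- g) n = fourier f n - fourier g n.
Proof. by move=> f2 g2; rewrite /fourier ipBl//; exact: L2_zn. Qed.

Lemma fourier_aeq f g n : L2 f -> L2 g -> aeq f g -> fourier f n = fourier g n.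
Proof.
by move=> f2 g2 fg; apply: ip_aeq => //; [exact: L2_zn|exact: L2_zn|exact: aeq_refl].
Qed.

Lemma fourier_cst a n : fourier (cst a) n = a * (n == 0)%:R.
Proof.
rewrite (_ : cst a = cst a \* zn 0); first by rewrite fourierZ ?fourier_zn 1?eq_sym//; exact: L2_zn.
by apply/funext => t /=; rewrite zn0 mulr1.
Qed.

Lemma fourier_shift m f n : fourier (zn m \* f) n = fourier f (n - m).
Proof.
rewrite /fourier /ip; congr cintegral; apply/funext => t /=.
rewrite /conjf -!/(zn _ _) -!znN opprB znD; ring.
Qed.

Lemma fourier_zT f n : fourier (@zT R \* f) n = fourier f (n - 1).
Proof.
rewrite -fourier_shift; congr fourier; apply/funext => t /=; by rewrite zn1.
Qed.

Lemma fourierJ f n : L2 f -> fourier (conjf f) n = (fourier f (- n))^*.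
Proof.
move=> f2; rewrite /fourier -ipC; [|exact: L2_zn|by []].
rewrite /ip; congr cintegral; apply/funext => t /=.
by rewrite -/(zn _ _) znN mulrC.
Qed.

Lemma fourier_lincomb k (c : 'I_k -> C) e n : (forall i, L2 (e i)) ->
  fourier (lincomb c e) n = \sum_i c i * fourier (e i) n.
Proof. by move=> e2; rewrite /fourier ip_lincombl//; exact: L2_zn. Qed.

End TrigonometricSystem.

(** * Density of the trigonometric polynomials *)

Section TrigonometricDensity.
Variable R : realType.
Local Notation C := R[i].
Local Notation mu := (arcm R).
Implicit Types (f g h p q : R -> C) (a b : C) (u v w : R -> R) (n m : int).
Implicit Types (A : set R).

(** Trigonometric polynomials with spectrum in S; proofs about them go by
    induction on the number of terms. *)
Inductive tspan (S : set int) : (R -> C) -> Prop :=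
| tspan0 : tspan S (cst 0)
| tspan_add a n f : S n -> tspan S f -> tspan S (cst a \* zn n \+ f).

Lemma tspan_ebounded S f : tspan S f -> ebounded f.
Proof.
elim=> [|a n g _ _ bg]; first exact: ebounded_cst.
by apply: eboundedD => //; apply: eboundedM; [exact: ebounded_cst|exact: ebounded_zn].
Qed.

Lemma tspan_L2 S f : tspan S f -> L2 f.
Proof. by move=> /tspan_ebounded/ebounded_L2. Qed.

Lemma tspanD S f g : tspan S f -> tspan S g -> tspan S (f \+ g).
Proof.
move=> Sf Sg; elim: Sf => [|a n h Sn _ ih].
  by rewrite (_ : _ \+ g = g)//; apply/funext => t /=; rewrite add0r.
rewrite (_ : _ \+ g = cst a \* zn n \+ (h \+ g)); first exact: tspan_add.
by apply/funext => t /=; rewrite addrA.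
Qed.

Lemma tspanZ S a f : tspan S f -> tspan S (cst a \* f).
Proof.
elim=> [|b n h Sn _ ih].
  rewrite (_ : cst a \* _ = cst 0); first exact: tspan0.
  by apply/funext => t /=; rewrite mulr0.
rewrite (_ : cst a \* _ = cst (a * b) \* zn n \+ (cst a \* h)).
  exact: tspan_add.
by apply/funext => t /=; rewrite mulrDr mulrA.
Qed.

Lemma tspan_zn S n : S n -> tspan S (zn n).
Proof.
move=> Sn; rewrite (_ : zn n = cst 1 \* zn n \+ cst 0).
  by apply: tspan_add => //; exact: tspan0.
by apply/funext => t /=; rewrite mul1r addr0.
Qed.

Lemma tspanM f g : tspan setT f -> tspan setT g -> tspan setT (f \* g).
Proof.
have zM n h : tspan setT h -> tspan setT (zn n \* h).
  elim=> [|b m k _ _ ih].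
    rewrite (_ : _ \* _ = cst 0); first exact: tspan0.
    by apply/funext => t /=; rewrite mulr0.
  rewrite (_ : _ \* _ = cst b \* zn (n + m) \+ (zn n \* k)).
    exact: tspan_add.
  by apply/funext => t /=; rewrite znD; ring.
move=> Sf Sg; elim: Sf => [|a n h _ _ ih].
  rewrite (_ : _ \* _ = cst 0); first exact: tspan0.
  by apply/funext => t /=; rewrite mul0r.
rewrite (_ : _ \* _ = cst a \* (zn n \* g) \+ (h \* g)).
  by apply: tspanD => //; apply: tspanZ; exact: zM.
by apply/funext => t /=; ring.
Qed.

Definition trigclosure f := L2 f /\
  forall e : R, 0 < e -> exists2 p, tspan setT p & sqnorm (f \- p) < e.

Lemma trigclosure_tspan p : tspan setT p -> trigclosure p.
Proof.
move=> Tp; split=> [|e e0]; first exact: tspan_L2 Tp.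
exists p => //; rewrite sqnorm0//; last by apply: L2B; exact: tspan_L2 Tp.
by apply: aeW => t /=; rewrite subrr.
Qed.

Lemma trigclosure_closed f : L2 f ->
  (forall e : R, 0 < e -> exists2 g, trigclosure g & sqnorm (f \- g) < e) ->
  trigclosure f.
Proof.
move=> f2 fE; split=> // e e0.
have e4 : 0 < e / 4 by lra.
have [g [g2 gE] fg] := fE _ e4; have [p Tp gp] := gE _ e4.
exists p => //; rewrite (_ : f \- p = (f \- g) \+ (g \- p)); last first.
  by apply/funext => t /=; rewrite addrA subrK.
have p2 := tspan_L2 Tp.
by have := sqnormD_le (L2B f2 g2) (L2B g2 p2); lra.
Qed.

Lemma trigclosureD f g : trigclosure f -> trigclosure g -> trigclosure (f \+ g).
Proof.
move=> [f2 fE] [g2 gE]; split=> [|e e0]; first exact: L2D.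
have e4 : 0 < e / 4 by lra.
have [p Tp fp] := fE _ e4; have [q Tq gq] := gE _ e4.
exists (p \+ q); first exact: tspanD.
rewrite (_ : _ \- _ = (f \- p) \+ (g \- q)); last first.
  by apply/funext => t /=; ring.
have p2 := tspan_L2 Tp; have q2 := tspan_L2 Tq.
by have := sqnormD_le (L2B f2 p2) (L2B g2 q2); lra.
Qed.

Lemma sqnorm_bound_lt g f (M e : R) : L2 f -> ebounded g ->
  (\forall t \ae mu, nsq (g t) <= M) -> sqnorm f < e / (`|M| + 1) -> 
  sqnorm (g \* f) < e.
Proof.
move=> f2 bg gM; rewrite ltr_pdivlMr; last by rewrite ltr_pwDr.
apply: le_lt_trans; rewrite mulrC; apply: sqnorm_mul_le => //.
by apply: filterS gM => t /le_trans; apply; rewrite (le_trans (ler_norm _))// lerDl.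
Qed.

(** With g bounded, f g is close to p g for a trigonometric polynomial p close
    to f; with p bounded, p g is close to p q for q close to g. *)
Lemma trigclosureM f g : ebounded f -> trigclosure f -> ebounded g ->
  trigclosure g -> trigclosure (f \* g).
Proof.
have base p h : tspan setT p -> trigclosure h -> trigclosure (p \* h).
  move=> Tp [h2 hE]; have bp := tspan_ebounded Tp; have [_ [M pM]] := bp.
  split=> [|e e0]; first exact: L2M.
  have [|q Tq hq] := hE (e / (`|M| + 1)); first by rewrite divr_gt0// ltr_pwDr.
  exists (p \* q); first exact: tspanM.
  rewrite (_ : _ \- _ = p \* (h \- q)).
    by apply: sqnorm_bound_lt pM _ => //; apply: L2B => //; exact: tspan_L2 Tq.
  by apply/funext => t /=; rewrite mulrBr.
move=> bf [f2 fE] bg Dg; have [_ [M gM]] := bg; have [g2 gE] := Dg.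
apply: trigclosure_closed => [|e e0]; first exact: L2M.
have [|p Tp fp] := fE (e / (`|M| + 1)); first by rewrite divr_gt0// ltr_pwDr.
exists (p \* g); first exact: base.
rewrite (_ : _ \- _ = g \* (f \- p)).
  by apply: sqnorm_bound_lt gM _ => //; apply: L2B => //; exact: tspan_L2 Tp.
by apply/funext => t /=; rewrite mulrBr ![g t * _]mulrC.
Qed.

Lemma trigclosureZ a f : trigclosure f -> trigclosure (cst a \* f).
Proof.
move=> [f2 fE]; split=> [|e e0]; first exact: L2Z.
have [|p Tp fp] := fE (e / (nsq a + 1)).
  by rewrite divr_gt0// ltr_wpDl ?nsq_ge0.
exists (cst a \* p); first exact: tspanZ.
rewrite (_ : _ \- _ = cst a \* (f \- p)); last first.
  by apply/funext => t /=; rewrite mulrBr.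
have p2 := tspan_L2 Tp; rewrite sqnormZ; last exact: L2B.
have := sqnorm_ge0 (f \- p); have := nsq_ge0 a.
move: fp; rewrite ltr_pdivlMr ?ltr_wpDl ?nsq_ge0// => fp a0 s0.
by apply: le_lt_trans fp; rewrite mulrC ler_wpM2l// lerDl.
Qed.

Definition rc u : R -> C := fun t => (u t)%:C.

Lemma nsq_rc u t : nsq (rc u t) = u t ^+ 2.
Proof. by rewrite /nsq /= expr0n addr0. Qed.

Lemma cmeasurable_rc u : measurable_fun [set: measurableTypeR R] u ->
  cmeasurable (rc u).
Proof. by move=> mu_; split=> //; exact: measurable_cst. Qed.

Lemma trigclosure_dominated (u_ : nat -> R -> R) u w :
  (forall k, trigclosure (rc (u_ k))) ->
  measurable_fun [set: measurableTypeR R] u -> rintegrable w ->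
  (forall k t, (u_ k t - u t) ^+ 2 <= w t) ->
  (forall t, u_ ^~ t @ \oo --> u t) -> trigclosure (rc u).
Proof.
move=> Du mu_ iw uw cu.
have mk k : measurable_fun [set: measurableTypeR R] (u_ k).
  by have [/L2_meas[]] := Du k.
have md k : measurable_fun [set: measurableTypeR R] (fun t => (u_ k t - u t) ^+ 2).
  by apply: measurable_funX; exact: measurable_funB.
have d2 k : L2 (rc (fun t => u_ k t - u t)).
  apply/L2P; split; first exact/cmeasurable_rc/measurable_funB.
  under eq_fun do rewrite nsq_rc.
  apply: (le_rintegrable (md k) iw); apply: aeW => t.
  by rewrite ger0_norm ?sqr_ge0.
have E k : rc u \- rc (u_ k) = \- rc (fun t => u_ k t - u t).
  by apply/funext => t; rewrite /rc /= -rmorphB -rmorphN opprB.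
apply: trigclosure_closed => [|e e0].
  have := L2B (Du 0%N).1 (d2 0%N); congr L2; apply/funext => t /=.
  by rewrite /rc -rmorphB opprB addrC subrK.
suff : (fun k => sqnorm (rc (fun t => u_ k t - u t))) @ \oo --> (0 : R).
  move=> /cvgrPdist_lt /(_ e e0) [k _ /(_ k (leqnn k)) /=].
  rewrite sub0r normrN ger0_norm ?sqnorm_ge0// => ke.
  by exists (rc (u_ k)) => //; rewrite E sqnormN.
have sqc t : (fun k => ((u_ k t - u t) ^+ 2)%:E) @ \oo --> (0%:E : \bar R).
  apply: cvg_EFin; first exact: nearW.
  rewrite (_ : (0 : R) = 0 ^+ 2); last by rewrite expr0n.
  apply: (@cvg_comp _ _ _ (fun k => u_ k t - u t) (fun x : R => x ^+ 2) _ (nbhs (0 : R))).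
    by rewrite -(subrr (u t)); apply: cvgB; [exact: cu|exact: cvg_cst].
  exact: exprn_continuous.
have := @dominated_convergence _ _ _ mu setT measurableT
  (fun k t => ((u_ k t - u t) ^+ 2)%:E) (cst 0%E) (EFin \o w).
case.
- by move=> k; apply/measurable_EFinP.
- exact: measurable_cst.
- by apply: aeW => t _; exact: sqc.
- exact: iw.
- by apply: aeW => t k _; rewrite lee_fin ger0_norm ?sqr_ge0.
move=> _ _; rewrite integral0 => /fine_cvg.
apply: cvg_trans; apply: near_eq_cvg; apply: nearW => k /=.
by rewrite sqnormE; congr fine; apply: eq_integral => t _; rewrite nsq_rc.
Qed.

Lemma trigclosure_aeq f g : cmeasurable g -> aeq f g ->
  trigclosure f -> trigclosure g.
Proof.
move=> mg fg [f2 fE]; have g2 := L2_aeq mg fg f2; split=> // e /fE[p Tp fp].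
exists p => //; have p2 := tspan_L2 Tp.
rewrite (sqnorm_aeq (L2B g2 p2) (L2B f2 p2))//.
by apply: filterS fg => t /= ->.
Qed.

Lemma eq_trigclosure u v : u =1 v -> trigclosure (rc u) -> trigclosure (rc v).
Proof. by move=> /funext ->. Qed.

Lemma trigclosure_rcD u v : trigclosure (rc u) -> trigclosure (rc v) ->
  trigclosure (rc (fun t => u t + v t)).
Proof.
move=> Du Dv; have := trigclosureD Du Dv; congr trigclosure.
by apply/funext => t; rewrite /rc /= rmorphD.
Qed.

Lemma trigclosure_rcZ (r : R) u : trigclosure (rc u) ->
  trigclosure (rc (fun t => r * u t)).
Proof.
move=> Du; have := trigclosureZ r%:C Du; congr trigclosure.
by apply/funext => t; rewrite /rc /= rmorphM.
Qed.

Lemma trigclosure_rcM u v (M N : R) : (forall t, `|u t| <= M) ->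
  (forall t, `|v t| <= N) -> trigclosure (rc u) -> trigclosure (rc v) ->
  trigclosure (rc (fun t => u t * v t)).
Proof.
have b w K : (forall t, `|w t| <= K) -> trigclosure (rc w) -> ebounded (rc w).
  move=> wK [w2 _]; split; first exact: L2_meas.
  exists (K ^+ 2); apply: aeW => t; rewrite nsq_rc -[w t ^+ 2]real_normK ?num_real//.
  by rewrite ler_pXn2r// nnegrE ?normr_ge0// (le_trans _ (wK t)).
move=> uM vN Du Dv; have := trigclosureM (b _ _ uM Du) Du (b _ _ vN Dv) Dv.
by congr trigclosure; apply/funext => t; rewrite /rc /= rmorphM.
Qed.

Lemma trigclosure_cst (r : R) : trigclosure (rc (fun=> r)).
Proof.
apply: trigclosure_tspan; rewrite (_ : rc _ = cst r%:C \* zn 0).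
  exact/tspanZ/tspan_zn.
by apply/funext => t; rewrite /= zn0 mulr1.
Qed.

Lemma trigclosure_cos : trigclosure (rc cos).
Proof.
apply: trigclosure_tspan.
rewrite (_ : rc _ = cst (2^-1)%:C \* zn 1 \+ cst (2^-1)%:C \* zn (-1)).
  by apply: tspanD; exact/tspanZ/tspan_zn.
apply/funext => t; rewrite /= (znN 1) !zn1 /rc /zT /=.
by simpc; congr Complex; field.
Qed.

Lemma trigclosure_sin : trigclosure (rc sin).
Proof.
apply: trigclosure_tspan.
rewrite (_ : rc _ = cst (0 -i* 2^-1) \* zn 1 \+ cst (0 +i* 2^-1) \* zn (-1)).
  by apply: tspanD; exact/tspanZ/tspan_zn.
apply/funext => t; rewrite /= (znN 1) !zn1 /rc /zT /=.
by simpc; congr Complex; field.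
Qed.

(** A polynomial with fixed points -1, 0 and 1 whose iterates converge to the
    sign function on [-1, 1]. *)
Definition cubic (x : R) : R := (3 * x - x ^+ 3) / 2.

Lemma cubicN x : cubic (- x) = - cubic x.
Proof. by rewrite /cubic; field. Qed.

Lemma iter_cubicN k x : iter k cubic (- x) = - iter k cubic x.
Proof. by elim: k => //= k ->; rewrite cubicN. Qed.

(** The iterates y increase, and 1 - cubic y = (1 - y) (2 - y - y^2) / 2, where
    the last factor is at most 1 - x / 2 as soon as y >= x. *)
Lemma iter_cubic_gt0 k x : 0 < x <= 1 ->
  x <= iter k cubic x <= 1 /\ 1 - iter k cubic x <= (1 - x / 2) ^+ k.
Proof.
move=> /andP[x0 x1]; elim: k => [|k [/andP[ih1 ih2] ih3]] /=.
  by rewrite lexx x1 expr0; split => //; lra.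
set y := iter k cubic x in ih1 ih2 ih3 *.
have y0 : 0 < y by apply: lt_le_trans ih1.
have E : 1 - cubic y = (1 - y) * ((2 - y - y ^+ 2) / 2) by rewrite /cubic; field.
have F : cubic y - y = y * (1 - y ^+ 2) / 2 by rewrite /cubic; field.
have y2 : y ^+ 2 <= 1 by rewrite expr2; nra.
have y20 : 0 <= y ^+ 2 by exact: sqr_ge0.
have G : 0 <= cubic y - y by rewrite F; apply: divr_ge0 => //; nra.
have H : 0 <= 1 - cubic y by rewrite E; apply: mulr_ge0; nra.
split; first by apply/andP; split; lra.
rewrite exprSr E; apply: ler_pM => //; try lra; nra.
Qed.

Lemma iter_cubic_le1 k x : `|x| <= 1 -> `|iter k cubic x| <= 1.
Proof.
have [x0|x0|<-] := ltrgtP 0 x.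
- rewrite gtr0_norm// => x1.
  have [|/andP[h1 h2] _] := @iter_cubic_gt0 k x; first by rewrite x0.
  by rewrite ger0_norm// (le_trans (ltW x0)).
- rewrite ltr0_norm// => x1.
  have [|/andP[h1 h2] _] := @iter_cubic_gt0 k (- x); first by rewrite oppr_gt0 x0.
  by rewrite -normrN -iter_cubicN ger0_norm// (le_trans _ h1)// oppr_ge0 ltW.
- move=> _; suff -> : iter k cubic 0 = 0 by rewrite normr0 ler01.
  by elim: k => //= k ->; rewrite /cubic; field.
Qed.

Lemma iter_cubic_cvg x : `|x| <= 1 ->
  (fun k => iter k cubic x) @ \oo --> Num.sg x.
Proof.
have pos y : 0 < y -> `|y| <= 1 -> (fun k => iter k cubic y) @ \oo --> (1 : R).
  move=> y0; rewrite gtr0_norm// => y1.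
  apply: (@squeeze_cvgr _ _ _ _ (fun k => 1 - (1 - y / 2) ^+ k) (cst 1)).
  - apply: nearW => k; have [|/andP[h1 h2] h3] := @iter_cubic_gt0 k y.
      by rewrite y0.
    by rewrite h2 andbT lerBlDr addrC -lerBlDr.
  - rewrite -[X in _ --> X]subr0; apply: cvgB; first exact: cvg_cst.
    apply: cvg_expr; rewrite ger0_norm; lra.
  - exact: cvg_cst.
have [x0|x0|<-] := ltrgtP 0 x.
- by move=> x1; rewrite gtr0_sg//; exact: pos.
- move=> x1; rewrite ltr0_sg//.
  rewrite (_ : (fun k => _) = (fun k => - iter k cubic (- x))).
    by apply: cvgN; apply: pos; rewrite ?oppr_gt0 ?normrN.
  by apply/funext => k; rewrite iter_cubicN opprK.
- move=> _; rewrite sgr0 (_ : (fun k => _) = cst 0); first exact: cvg_cst.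
  by apply/funext => k; elim: k => //= k ->; rewrite /cubic; field.
Qed.

Lemma trigclosure_iter_cubic k u : (forall t, `|u t| <= 1) ->
  trigclosure (rc u) -> trigclosure (rc (fun t => iter k cubic (u t))).
Proof.
move=> u1 Du; elim: k => [|k ih] //=.
set v := fun t => iter k cubic (u t) in ih *.
have v1 t : `|v t| <= 1 by exact: iter_cubic_le1.
have D2 := trigclosure_rcM v1 v1 ih ih.
have vv1 t : `|v t * v t| <= 1 by rewrite normrM mulr_ile1.
have D3 := trigclosure_rcM v1 vv1 ih D2.
have := trigclosure_rcD (trigclosure_rcZ (3 / 2) ih) (trigclosure_rcZ (- 2^-1) D3).
apply: eq_trigclosure => t.
by rewrite /cubic -/(v t); field.
Qed.

(** The indicator function of {u > 0} is (s + s^2) / 2 with s the sign of u. *)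
Lemma trigclosure_gt0 u : (forall t, `|u t| <= 1) -> trigclosure (rc u) ->
  trigclosure (rc (fun t => (0 < u t)%R%:R)).
Proof.
move=> u1 Du; have mu_ : measurable_fun [set: measurableTypeR R] u.
  by have [/L2_meas[]] := Du.
have sg1 (x : R) : `|Num.sg x| <= 1 by rewrite normr_sg lern1 leq_b1.
have msg : measurable_fun [set: measurableTypeR R] (fun t => Num.sg (u t)).
  rewrite (_ : (fun t => _) =
     (fun t => if u t == 0 then 0 else if u t < 0 then -1 else 1)) //.
  apply: measurable_fun_ifT => //; first exact: measurable_fun_eqr.
  apply: measurable_fun_ifT => //.
  exact: measurable_fun_ltr.
have Dsg : trigclosure (rc (fun t => Num.sg (u t))).
  apply: (@trigclosure_dominated (fun k t => iter k cubic (u t)) _ (cst 4)).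
  - by move=> k; exact: trigclosure_iter_cubic.
  - exact: msg.
  - exact: rintegrable_cst.
  - move=> k t /=; have := iter_cubic_le1 k (u1 t); have := sg1 (u t).
    by rewrite !ler_norml => /andP[? ?] /andP[? ?]; nra.
  - by move=> t; exact: iter_cubic_cvg.
have D2 := trigclosure_rcM (fun t => sg1 (u t)) (fun t => sg1 (u t)) Dsg Dsg.
have := trigclosure_rcZ 2^-1 (trigclosure_rcD Dsg D2).
apply: eq_trigclosure => t.
by case: sgrP => _; rewrite ?mul0r ?mulr0 ?addr0 ?mulr0//=; field.
Qed.

Lemma ae_neq (a : R) : \forall t \ae mu, t != a.
Proof.
exists [set a]; split; [exact: measurable_set1| |].
- have /null_content_dominatesP := dominates_uniform_prob (twopi_gt0 R).
  by apply; [exact: measurable_set1|exact: lebesgue_measure_set1].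
- by move=> t /= /negP; rewrite negbK => /eqP.
Qed.

Lemma ae_in_circle : \forall t \ae mu, 0 < t < 2 * pi.
Proof.
have inI : \forall t \ae mu, t \in `[0, 2 * pi].
  exists (~` `[0, 2 * pi]%classic); split.
  - by apply: measurableC; exact: measurable_itv.
  - have := @probability_setC _ _ _ mu `[0, 2 * pi]%classic (measurable_itv _).
    move=> ->; rewrite [X in (_ - X)%E](_ : _ = 1%E) ?subee//.
    by rewrite /arcm/= /uniform_prob integral_uniform_pdf1// twopi_gt0.
  - by [].
apply: filterS3 (ae_neq 0) (ae_neq (2 * pi)) inI => t t0 t1.
by rewrite in_itv/= => /andP[h0 h1]; rewrite !lt_neqAle eq_sym t0 t1 h0 h1.
Qed.

Lemma trigclosure_cosgt (c : R) : `|c| <= 1 ->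
  trigclosure (rc (fun t => (c < cos t)%R%:R)).
Proof.
move=> c1.
have D : trigclosure (rc (fun t => 2^-1 * (cos t + - c))).
  exact/trigclosure_rcZ/trigclosure_rcD/trigclosure_cst/trigclosure_cos.
have b t : `|2^-1 * (cos t + - c)| <= 1.
  have := cos_le1 t; have := cos_geN1 t; move: c1.
  by rewrite !ler_norml => /andP[? ?] *; apply/andP; split; lra.
have := trigclosure_gt0 b D; congr trigclosure; apply/funext => t.
by rewrite /rc pmulr_rgt0 ?invr_gt0// subr_gt0.
Qed.

Lemma trigclosure_singt0 (s : R) : `|s| <= 1 ->
  trigclosure (rc (fun t => (0 < s * sin t)%R%:R)).
Proof.
move=> s1; apply: trigclosure_gt0; last exact/trigclosure_rcZ/trigclosure_sin.
by move=> t; rewrite normrM mulr_ile1// ler_norml sin_geN1 sin_le1.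
Qed.

Lemma sin_circle (t : R) : 0 < t < 2 * pi ->
  ((0 < sin t) = (t < pi)) * ((0 < - sin t) = (pi < t)).
Proof.
move=> /andP[t0 t2].
have neg (x : R) : pi < x < 2 * pi -> sin x < 0.
  move=> /andP[h1 h2].
  have := @sin_gt0_pi R (x - pi); rewrite sinB cospi sinpi mulr0 subr0 mulrN1.
  by rewrite oppr_gt0; apply; apply/andP; split; lra.
have [tp|tp|tp] := ltrgtP t pi.
- have := @sin_gt0_pi R t; rewrite t0 tp => /(_ isT) h.
  by rewrite h oppr_gt0 ltNge (ltW h).
- have := neg t; rewrite t2 tp => /(_ isT) h.
  by rewrite oppr_gt0 h ltNge (ltW h).
- by rewrite tp sinpi oppr0 ltxx.
Qed.

(** Up to null sets, {t <= x} is {cos t > cos x, sin t > 0} for x <= pi, and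
    the complement of {cos t > cos x, sin t < 0} for x > pi. *)
Lemma trigclosure_ray (x : R) : trigclosure (rc (fun t => (t <= x)%R%:R)).
Proof.
have p0 := pi_gt0 R.
have m : cmeasurable (rc (fun t : R => (t <= x)%R%:R)).
  apply: cmeasurable_rc; rewrite (_ : (fun t => _) = \1_`]-oo, x]%classic).
    by apply: measurable_indic; exact: measurable_itv.
  by apply/funext => t; rewrite indicE mem_setE in_itv.
have b1 (b : bool) : `|b%:R : R| <= 1 by case: b; rewrite ?normr1 ?normr0.
have [x0|x0] := leP x 0.
  apply: trigclosure_aeq (trigclosure_cst 0) => //.
  apply: filterS ae_in_circle => t /andP[h _]; rewrite /rc.
  by rewrite leNgt (le_lt_trans x0 h).
have [x2|x2] := leP (2 * pi) x.
  apply: trigclosure_aeq (trigclosure_cst 1) => //.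
  apply: filterS ae_in_circle => t /andP[_ h]; rewrite /rc.
  by rewrite (le_trans (ltW h) x2).
have c1 : `|cos x| <= 1 by rewrite ler_norml cos_geN1 cos_le1.
have [xp|xp] := leP x pi.
  have s1 : `|1 : R| <= 1 by rewrite normr1.
  have := trigclosure_rcM (fun t => b1 _) (fun t => b1 _) (trigclosure_cosgt c1)
    (trigclosure_singt0 s1).
  apply: trigclosure_aeq => //.
  apply: filterS2 ae_in_circle (ae_neq x) => t tc tx.
  rewrite /rc; congr (real_complex R _); rewrite -natrM mulnb mul1r sin_circle//.
  congr (_%:R); have [h|h] := leP t x.
  - have tlx : t < x by rewrite lt_neqAle tx.
    rewrite (lt_le_trans tlx xp) andbT ltr_cos ?in_itv/= ?tlx//.
      by case/andP: tc => /ltW -> _; rewrite (le_trans h xp).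
    by rewrite (ltW x0).
  - case: (ltP t pi) => tp; last by rewrite andbF.
    rewrite andbT ltr_cos ?in_itv/= ?(ltW x0) ?(ltW tp) ?andbT//.
      by rewrite ltNge (ltW h).
    by case/andP: tc => /ltW.
have s1 : `|- 1 : R| <= 1 by rewrite normrN normr1.
have := trigclosure_rcM (fun t => b1 _) (fun t => b1 _) (trigclosure_cosgt c1)
  (trigclosure_singt0 s1).
move=> /(trigclosure_rcZ (-1)) /(trigclosure_rcD (trigclosure_cst 1)).
apply: trigclosure_aeq => //; apply: filterS ae_in_circle => t tc.
rewrite /rc; congr (real_complex R _); rewrite -natrM mulnb [-1 * sin t]mulN1r sin_circle//.
have cosC (y : R) : cos y = cos (2 * pi - y).
  by rewrite cosB mulr_natl cos2pi sin2pi mul0r mul1r addr0.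
have E : pi < t -> (cos x < cos t) = (x < t).
  move=> tp; case/andP: tc => t0 t2.
  rewrite [cos x]cosC [cos t]cosC ltr_cos ?in_itv/= ?ltrD2l ?ltrN2//.
  - by apply/andP; split; lra.
  - by apply/andP; split; lra.
have [h|h] := leP t x.
- case: (ltP pi t) => tp; last by rewrite andbF mulr0 addr0.
  by rewrite E// ltNge h /= mulr0 addr0.
- have tp : pi < t by rewrite (lt_trans xp).
  by rewrite tp E// h /= mulN1r subrr.
Qed.

(** Indicator functions of disjoint unions are bounded pointwise limits, so
    that the sets in question form a Dynkin system. *)
Lemma trigclosure_indic (A : set (measurableTypeR R)) : measurable A ->
  trigclosure (rc \1_A).
Proof.
rewrite -[measurable A]/(<<s @ocitv R >> A).
apply: (@dynkin_induction _ (measurableTypeR R) (@ocitv R)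
  (fun A => trigclosure (rc \1_A))) => //.
- exact: ocitvI.
- rewrite (_ : \1_setT = fun=> 1); first exact: trigclosure_cst.
  by apply/funext => t; rewrite indicE in_setT.
- move=> _ [[a b] _ <-] /=.
  have [ab|ab] := leP a b; last first.
    rewrite set_itv_ge ?bnd_simp -?leNgt ?(ltW ab)//.
    rewrite (_ : \1_set0 = fun=> 0); first exact: trigclosure_cst.
    by apply/funext => t; rewrite indicE in_set0.
  have := trigclosure_rcD (trigclosure_ray b) (trigclosure_rcZ (-1) (trigclosure_ray a)).
  apply: eq_trigclosure => t.
  rewrite indicE mem_setE in_itv /=.
  case: (leP t a) => ta.
    by rewrite (le_trans ta ab) /= mulr1 subrr.
  by rewrite mulr0 addr0.
- move=> B mB DA.
  have := trigclosure_rcD (trigclosure_cst 1) (trigclosure_rcZ (-1) DA).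
  apply: eq_trigclosure => t.
  rewrite !indicE in_setC; case: (t \in B) => /=; first by rewrite mulr1 subrr.
  by rewrite mulr0 addr0.
- move=> F mF tF DF.
  have E t k : \sum_(i < k) \1_(F i) t =
      (if pselect ((\bigcup_i F i) t) is left H then
         (projT1 (cid2 H) < k)%:R else 0) :> R.
    case: pselect => [H|nH].
      case: cid2 => n _ Fn /=.
      have FE i : \1_(F i) t = (i == n)%:R :> R.
        rewrite indicE; case: eqP => [->|/eqP ni]; first by rewrite mem_set.
        rewrite memNset// => Fi; move/eqP: ni; apply.
        by apply: (tF i n) => //; exists t.
      under eq_bigr do rewrite FE.
      case: ltnP => nk.
        rewrite (bigD1 (Ordinal nk))//= eqxx big1 ?addr0// => i.
        by rewrite -val_eqE /= => /negbTE ->.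
      rewrite big1// => i _; case: eqP => // in_; move: (ltn_ord i).
      by rewrite in_ ltnNge nk.
    rewrite big1// => i _; rewrite indicE memNset// => Fi; apply: nH.
    by exists (i : nat).
  apply: (@trigclosure_dominated (fun k t => \sum_(i < k) \1_(F i) t) _ (cst 1)).
  + elim=> [|k ih].
      have := trigclosure_cst 0; congr trigclosure; apply/funext => t.
      by rewrite /rc big_ord0.
    have := trigclosure_rcD ih (DF k); congr trigclosure; apply/funext => t.
    by rewrite /rc big_ord_recr.
  + exact/measurable_indic/bigcupT_measurable.
  + exact: rintegrable_cst.
  + move=> k t /=; rewrite E indicE; case: pselect => [H|H].
      rewrite mem_set//; case: (_ < _)%N; rewrite ?subrr ?expr0n ?ler01//=.
      by rewrite sub0r sqrrN expr1n.
    by rewrite memNset// subrr expr0n ler01.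
  + move=> t; apply: cvg_near_cst; case: (pselect ((\bigcup_i F i) t)) => [H|H].
      exists (projT1 (cid2 H)).+1 => // k /= nk; rewrite E.
      case: pselect => // H'; rewrite (Prop_irrelevance H' H) nk indicE mem_set//.
    by apply: nearW => k; rewrite E; case: pselect => // _; rewrite indicE memNset.
Qed.

Import HBNNSimple.

Lemma trigclosure_ge0 u : measurable_fun [set: measurableTypeR R] u ->
  rintegrable (fun t => u t ^+ 2) -> (forall t, 0 <= u t) -> trigclosure (rc u).
Proof.
move=> mu_ iu u0.
have mE : measurable [set: measurableTypeR R] by exact: measurableT.
have mEu : measurable_fun [set: measurableTypeR R] (EFin \o u) by exact/measurable_EFinP.
pose u_ := nnsfun_approx mE mEu.
have cu t : (fun k => u_ k t) @ \oo --> u t.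
  have := @cvg_nnsfun_approx _ _ _ _ mE _ mEu.
  have uE0 x : [set: measurableTypeR R] x -> (0 <= (EFin \o u) x)%E.
    by move=> _; rewrite lee_fin.
  by move=> /(_ uE0 t I) h; exact: (fine_cvg h).
have u_le k t : u_ k t <= u t.
  have nd : {homo (fun k => u_ k t) : n m / (n <= m)%N >-> n <= m}.
    by move=> n m /(nd_nnsfun_approx mE mEu) /lefP.
  have := nondecreasing_cvgn_le nd (cvgP _ (cu t)) k.
  by rewrite (cvg_lim _ (cu t)).
apply: (@trigclosure_dominated (fun k t => u_ k t) _ (fun t => u t ^+ 2)) => //.
- move=> k; rewrite (_ : rc _ = rc (fun t =>
     \sum_(i < size (finmap.enum_fset (fset_set (range (u_ k)))))
      (finmap.enum_fset (fset_set (range (u_ k))))`_i *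
      \1_(u_ k @^-1` [set (finmap.enum_fset (fset_set (range (u_ k))))`_i]) t)); last first.
    by apply/funext => t; rewrite /rc fimfunEord.
  set c := finmap.enum_fset _.
  have : forall i : 'I_(size c), trigclosure (rc (fun t => c`_i * \1_(u_ k @^-1` [set c`_i]) t)).
    by move=> i; apply/trigclosure_rcZ/trigclosure_indic/measurable_funPTI.
  move: (size c) => n; elim: n => [_|n ih h].
    have := trigclosure_cst 0; congr trigclosure; apply/funext => t.
    by rewrite /rc big_ord0.
  have := trigclosure_rcD (ih (fun i => h (widen_ord (leqnSn n) i))) (h ord_max).
  by apply: eq_trigclosure => t; rewrite big_ord_recr.
- move=> k t; rewrite -sqrrN opprB ler_pXn2r// ?nnegrE ?subr_ge0//.
  by rewrite gerBl.
Qed.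

Theorem trig_dense f : L2 f -> trigclosure f.
Proof.
have real u : (u : measurableTypeR R -> R) \in Lfun mu 2%:E -> trigclosure (rc u).
  move=> /Lfun2P[mu_ iu].
  have D w : (w = u \/ w = (fun t => - u t)) -> trigclosure (rc (fun t => Num.max (w t) 0)).
    move=> wu; have mw : measurable_fun [set: measurableTypeR R] w.
      by case: wu => -> //; exact: measurable_funN.
    have mm : measurable_fun [set: measurableTypeR R] (fun t => Num.max (w t) 0).
      exact: measurable_maxr.
    apply: trigclosure_ge0 => //; last by move=> t; rewrite le_max lexx orbT.
    apply: (le_rintegrable _ iu); first exact: measurable_funX.
    apply: aeW => t; rewrite ger0_norm ?sqr_ge0//.
    have -> : u t ^+ 2 = w t ^+ 2 by case: wu => -> //; rewrite sqrrN.
    by rewrite maxEle; case: ifP => _; rewrite ?expr0n/= ?sqr_ge0.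
  have := trigclosure_rcD (D u (or_introl erefl))
    (trigclosure_rcZ (-1) (D _ (or_intror erefl))).
  apply: eq_trigclosure => t.
  rewrite mulN1r; case: (ltP (u t) 0) => h.
    by rewrite max_l ?oppr_ge0 ?(ltW h)// add0r opprK.
  by rewrite max_r ?oppr_le0// subr0.
move=> [rf jf]; have := trigclosureD (real _ rf) (trigclosureZ 'i (real _ jf)).
congr trigclosure; apply/funext => t; rewrite /rc /=.
by case: (f t) => x y /=; simpc.
Qed.

End TrigonometricDensity.

(** * The Hardy space *)

Section HardySpace.
Variable R : realType.
Local Notation C := R[i].
Local Notation mu := (arcm R).
Implicit Types (f g h p q u v x y : R -> C) (a b : C) (n m : int).

Lemma cauchy_schwarz u v : L2 u -> L2 v ->
  nsq (ip u v) <= sqnorm u * sqnorm v.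
Proof.
move=> u2 v2; have [v0|v0] := eqVneq (sqnorm v) 0.
  by rewrite ip_small// v0 mulr0 /nsq /= expr0n addr0.
pose c := ip u v / (sqnorm v)%:C; pose w := u \- cst c \* v.
have c2 : L2 (cst c \* v) by exact: L2Z.
have w2 : L2 w by exact: L2B.
have wv : ip w (cst c \* v) = 0.
  rewrite ipZr// ipBl// ipZl// ipff /c divfK ?subrr ?mulr0//.
  by apply/eqP => /complexI; exact/eqP.
have := sqnormD w2 c2 wv; rewrite (_ : w \+ _ = u); last first.
  by apply/funext => t; rewrite /w /= subrK.
rewrite sqnormZ// => ->; rewrite mulrDl -mulrA.
have v1 := sqnorm_ge0 v.
suff -> : nsq c * (sqnorm v * sqnorm v) = nsq (ip u v).
  by rewrite lerDr mulr_ge0 ?sqnorm_ge0.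
have -> : sqnorm v * sqnorm v = nsq (sqnorm v)%:C by rewrite /nsq /= expr0n addr0.
rewrite -nsqM /c divfK//; by apply/eqP => /complexI; exact/eqP.
Qed.

Lemma nsq_fourier_le f n : L2 f -> nsq (fourier f n) <= sqnorm f.
Proof.
move=> f2; apply: le_trans (cauchy_schwarz f2 (L2_zn R n)) _.
rewrite (_ : sqnorm (zn n) = 1) ?mulr1//.
by apply: complexI; rewrite -ipff ip_zn eqxx.
Qed.

Lemma ip_tspan S f p : L2 f -> (forall n, S n -> fourier f n = 0) ->
  tspan S p -> ip f p = 0.
Proof.
move=> f2 fS; elim=> [|a n q Sn Tq ih]; first exact: ip0r.
have q2 := tspan_L2 Tq.
rewrite ipDr//; last exact/L2Z/L2_zn.
by rewrite ih addr0 ipZr//; [rewrite [ip _ _]fS// mulr0|exact: L2_zn].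
Qed.

(** A function all whose Fourier coefficients vanish is orthogonal to the
    trigonometric polynomials, which come arbitrarily close to it. *)
Lemma fourier_inj f : L2 f -> (forall n, fourier f n = 0) -> aeq f (cst 0).
Proof.
move=> f2 f0; apply: sqnorm_eq0 => //; apply/eqP; rewrite eq_le sqnorm_ge0 andbT.
rewrite leNgt; apply/negP => f_gt0.
have [_ /(_ _ f_gt0)[p Tp]] := trig_dense f2; have p2 := tspan_L2 Tp.
have -> : f \- p = f \+ (cst (-1) \* p).
  by apply/funext => t /=; rewrite mulN1r.
rewrite sqnormD//; [|exact: L2Z|by rewrite ipZr// (@ip_tspan setT) ?mulr0].
by rewrite ltNge lerDl sqnorm_ge0.
Qed.

Lemma tspan_split p : tspan setT p -> exists p1 p2,
  [/\ tspan [set n : int | 0 <= n] p1, tspan [set n : int | n < 0] p2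
    & p = p1 \+ p2].
Proof.
elim=> [|a n q _ _ [p1 [p2 [T1 T2 ->]]]].
  exists (cst 0), (cst 0); split; [exact: tspan0|exact: tspan0|].
  by apply/funext => t /=; rewrite addr0.
have [n0|n0] := leP 0 n.
- exists (cst a \* zn n \+ p1), p2; split => //; first exact: tspan_add.
  by apply/funext => t /=; rewrite addrA.
- exists p1, (cst a \* zn n \+ p2); split => //; first exact: tspan_add.
  by apply/funext => t /=; rewrite addrCA.
Qed.

Lemma H2_L2 f : H2 f -> L2 f. Proof. by case. Qed.

Lemma H2_neg f n : H2 f -> n < 0 -> fourier f n = 0.
Proof. by move=> [_ fn]; case: n => // n _; rewrite NegzE fn. Qed.

Lemma H2P f : L2 f -> (forall n, n < 0 -> fourier f n = 0) -> H2 f.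
Proof. by move=> f2 fn; split=> // n; apply: fn; rewrite oppr_lt0. Qed.

(** The analytic part of a trigonometric polynomial close to a function of
    the Hardy space is still closer to it. *)
Lemma H2_approx f (e : R) : H2 f -> 0 < e ->
  exists2 p, tspan [set n : int | 0 <= n] p & sqnorm (f \- p) < e.
Proof.
move=> Hf e0; have f2 := H2_L2 Hf; have [_ /(_ _ e0)[p Tp fp]] := trig_dense f2.
have [p1 [p2 [T1 T2 pE]]] := tspan_split Tp.
exists p1 => //; apply: le_lt_trans fp.
have s1 := tspan_L2 T1; have s2 := tspan_L2 T2.
have -> : f \- p = (f \- p1) \+ (cst (-1) \* p2).
  by rewrite pE; apply/funext => t /=; rewrite mulN1r opprD addrA.
have s3 : L2 (f \- p1) by exact: L2B.
have s4 : L2 (cst (-1) \* p2) by exact: L2Z.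
suff o : ip (f \- p1) (cst (-1) \* p2) = 0 by rewrite (sqnormD s3 s4 o) lerDl sqnorm_ge0.
rewrite ipZr// (@ip_tspan [set n : int | n < 0] _ _ s3 _ T2) ?mulr0//.
move=> n /= n0; rewrite fourierB// H2_neg// sub0r.
rewrite [fourier _ _]ipC//; last exact: L2_zn.
rewrite (@ip_tspan [set n : int | 0 <= n] _ _ (L2_zn R n) _ T1) ?conjC0 ?oppr0//.
by move=> k /= k0; rewrite fourier_zn; case: eqP => // nk; move: n0; rewrite nk ltNge k0.
Qed.

(** It is obvious for f an analytic polynomial, and these are dense in H^2. *)
Lemma H2_ortho f h : H2 f -> H2 h -> at0 h = 0 -> ip f (conjf h) = 0.
Proof.
move=> Hf Hh h0; have f2 := H2_L2 Hf; have h2 := H2_L2 Hh; have hc := L2J h2.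
have hz n : 0 <= n -> fourier (conjf h) n = 0.
  move=> n0; rewrite fourierJ//; move: n0; rewrite le_eqVlt => /predU1P[<-|n0].
    by rewrite oppr0 [fourier _ _]h0 conjC0.
  by rewrite H2_neg ?conjC0// oppr_lt0.
have [h00|h00] := eqVneq (sqnorm (conjf h)) 0; first exact: ip_small.
have hp : 0 < sqnorm (conjf h) by rewrite lt_neqAle eq_sym h00 sqnorm_ge0.
apply: nsq_eq0; apply/eqP; rewrite eq_le nsq_ge0 andbT leNgt; apply/negP => i0.
have [|p Tp] := @H2_approx f (nsq (ip f (conjf h)) / sqnorm (conjf h)) Hf.
  by rewrite divr_gt0.
have p2 := tspan_L2 Tp.
rewrite ltr_pdivlMr// ltNge => /negP; apply.
have -> : ip f (conjf h) = ip (f \- p) (conjf h).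
  by rewrite ipBl// [ip p _]ipC// (ip_tspan hc hz Tp) conjC0 subr0.
by apply: cauchy_schwarz => //; exact: L2B.
Qed.

Definition linclosed (X : set (R -> C)) := X (cst 0) /\
  forall a x y, X x -> X y -> X (cst a \* x \+ y).

Definition aeclosed (X : set (R -> C)) :=
  forall f g, cmeasurable g -> aeq f g -> X f -> X g.

Lemma linclosedD X x y : linclosed X -> X x -> X y -> X (x \+ y).
Proof.
move=> [_ l] Xx Xy; rewrite (_ : x \+ y = cst 1 \* x \+ y); first exact: l.
by apply/funext => t /=; rewrite mul1r.
Qed.

Lemma linclosedZ X a x : linclosed X -> X x -> X (cst a \* x).
Proof.
move=> [X0 l] Xx; rewrite (_ : _ \* _ = cst a \* x \+ cst 0); first exact: l.
by apply/funext => t /=; rewrite addr0.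
Qed.

Lemma linclosed_lincomb X k (c : 'I_k -> C) e : linclosed X ->
  (forall i, X (e i)) -> X (lincomb c e).
Proof.
move=> lX Xe; rewrite (_ : lincomb c e = \sum_i (cst (c i) \* e i)).
  apply: big_ind => [|f g Xf Xg|i _]; [by case: lX|exact: linclosedD|exact: linclosedZ].
by apply/funext => t; rewrite /lincomb fct_sumE.
Qed.

Lemma linclosedI X Y : linclosed X -> linclosed Y -> linclosed (X `&` Y).
Proof.
move=> [X0 lX] [Y0 lY]; split=> // a x y [Xx Yx] [Xy Yy].
by split; [exact: lX|exact: lY].
Qed.

Lemma linclosed_L2 : linclosed (@L2 R).
Proof. by split=> [|a x y x2 y2]; [exact: L2_cst|apply: L2D => //; exact: L2Z]. Qed.

Lemma linclosed_cmeas : linclosed (@cmeasurable R).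
Proof.
split=> [|a x y mx my]; first exact: cmeasurable_cst.
by apply: cmeasurableD => //; apply: cmeasurableM => //; exact: cmeasurable_cst.
Qed.

Lemma linclosed_H2 : linclosed (@H2 R).
Proof.
split=> [|a x y Hx Hy]; apply: H2P.
- exact: L2_cst.
- by move=> n n0; rewrite fourier_cst mul0r.
- by apply: linclosed_L2.2; exact: H2_L2.
- move=> n n0; have x2 := H2_L2 Hx; have y2 := H2_L2 Hy.
  by rewrite fourierD ?fourierZ//; [rewrite !H2_neg// mulr0 addr0|exact: L2Z].
Qed.

Lemma aeclosed_H2 : aeclosed (@H2 R).
Proof.
move=> f g mg fg Hf; have f2 := H2_L2 Hf; have g2 := L2_aeq mg fg f2.
by apply: H2P => // n n0; rewrite -(fourier_aeq _ f2 g2 fg) H2_neg.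
Qed.

Lemma H2_zT f : H2 f -> H2 (@zT R \* f) /\ at0 (@zT R \* f) = 0.
Proof.
move=> Hf; have f2 := H2_L2 Hf; split.
  apply: H2P; first by apply: L2M => //; exact: ebounded_zT.
  by move=> n n0; rewrite fourier_zT H2_neg//; lia.
by rewrite /at0 fourier_zT H2_neg.
Qed.

Definition H20 : set (R -> C) := [set f | H2 f /\ at0 f = 0].

Lemma linclosed_H20 : linclosed H20.
Proof.
split=> [|a x y [Hx x0] [Hy y0]]; split.
- by case: linclosed_H2.
- by rewrite /at0 fourier_cst mul0r.
- exact: linclosed_H2.2.
- have x2 := H2_L2 Hx; have y2 := H2_L2 Hy.
  rewrite /at0 fourierD//; last exact: L2Z.
  by rewrite fourierZ// [fourier x 0]x0 [fourier y 0]y0 mulr0 addr0.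
Qed.

Lemma linclosed_conjH20 : linclosed (@conjH20 R).
Proof.
split=> [|a _ _ [x Hx <-] [y Hy <-]].
  exists (cst 0); first exact: linclosed_H20.1.
  by apply/funext => t; rewrite /conjf conjC0.
exists (cst a^* \* x \+ y); first exact: linclosed_H20.2.
by apply/funext => t; rewrite /conjf /= rmorphD rmorphM /= conjCK.
Qed.

Lemma linclosed_mulset u X : linclosed X -> linclosed (mulset u X).
Proof.
move=> lX; split=> [|a f g [mf [x Xx /aeqP fx]] [mg [y Xy /aeqP gy]]].
  split; first exact: cmeasurable_cst.
  exists (cst 0); first by case: lX.
  by apply/aeqP; apply: aeW => t /=; rewrite mulr0.
split; first exact: linclosed_cmeas.2.
exists (cst a \* x \+ y); first exact: lX.2.
by apply/aeqP; apply: filterS2 fx gy => t /= -> ->; ring.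
Qed.

Lemma linclosed_sumset X Y : linclosed X -> linclosed Y -> linclosed (sumset X Y).
Proof.
move=> lX lY; split=> [|a f g [mf [x [y [Xx Yy /aeqP fE]]]] [mg [x' [y' [Xx' Yy' /aeqP gE]]]]].
  split; first exact: cmeasurable_cst.
  exists (cst 0), (cst 0); split; [by case: lX|by case: lY|].
  by apply/aeqP; apply: aeW => t /=; rewrite addr0.
split; first exact: linclosed_cmeas.2.
exists (cst a \* x \+ x'), (cst a \* y \+ y'); split; [exact: lX.2|exact: lY.2|].
by apply/aeqP; apply: filterS2 fE gE => t /= -> ->; ring.
Qed.

Lemma linclosed_modelspace I : linclosed (modelspace I).
Proof.
apply: linclosedI; last exact: linclosed_H2.
exact/linclosed_mulset/linclosed_conjH20.
Qed.

Lemma linclosed_ominus X Y : X `<=` @L2 R -> Y `<=` @L2 R ->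
  linclosed X -> linclosed (ominus X Y).
Proof.
move=> X2 Y2 lX; split=> [|a f g [Xf fY] [Xg gY]].
  by split; [case: lX|move=> y Yy; rewrite ip0l//; exact: Y2].
split; first exact: lX.2.
move=> y Yy; have f2 := X2 _ Xf; have g2 := X2 _ Xg; have y2 := Y2 _ Yy.
by rewrite ipDl//; [rewrite ipZl// fY// gY// mulr0 addr0|exact: L2Z].
Qed.

Lemma modelspaceP I f : modelspace I f <->
  H2 f /\ exists2 h, H20 h & aeq f (I \* conjf h).
Proof.
split=> [[[mf [_ [h Hh <-] /aeqP fE]] Hf]|[Hf [h Hh fE]]].
  by split=> //; exists h.
split=> //; split; first exact/L2_meas/H2_L2.
by exists (conjf h); [exists h|exact/aeqP].
Qed.

Lemma modelspace_L2 I : modelspace I `<=` @L2 R.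
Proof. by move=> f [_ /H2_L2]. Qed.

Lemma linclosed_modelperp I : linclosed (modelperp I).
Proof.
apply: linclosed_ominus linclosed_L2 => //; exact: modelspace_L2.
Qed.

Lemma aeclosed_modelperp I : aeclosed (modelperp I).
Proof.
move=> f g mg fg [f2 fI]; have g2 := L2_aeq mg fg f2; split=> // y Iy.
have y2 := modelspace_L2 Iy.
by rewrite -(ip_aeq f2 y2 g2 y2 fg (aeq_refl y)) fI.
Qed.

Lemma aeclosed_modelspace I : aeclosed (modelspace I).
Proof.
move=> f g mg fg /modelspaceP[Hf [h Hh fE]]; apply/modelspaceP.
split; first exact: aeclosed_H2 fg Hf.
by exists h => //; apply: aeq_trans fE; exact: aeq_sym.
Qed.

End HardySpace.

(** * The kernel of the dual truncated Toeplitz operator *)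

Section DualTruncatedToeplitzKernel.
Variable R : realType.
Local Notation C := R[i].
Local Notation mu := (arcm R).
Implicit Types (f g h p q u v x y : R -> C) (a b : C) (n m : int).

Lemma ip_eq_integrand f h f' h' : L2 f -> L2 h -> L2 f' -> L2 h' ->
  aeq (f \* conjf h) (f' \* conjf h') -> ip f h = ip f' h'.
Proof.
move=> f2 h2 f2' h2' E; apply: cintegral_aeq => //; apply: cmeasurableM.
- exact: L2_meas.
- exact/cmeasurable_conj/L2_meas.
- exact: L2_meas.
- exact/cmeasurable_conj/L2_meas.
Qed.

Variable theta : R -> C.
Hypothesis theta_inner : inner_function theta.

Lemma inner_nsq : \forall t \ae mu, nsq (theta t) = 1.
Proof.
case: theta_inner => _ /aeqP; apply: filterS => t /= E.
by apply: complexI; rewrite nsq_norm E expr1n.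
Qed.

Lemma inner_mulcJ : \forall t \ae mu, theta t * (theta t)^* = 1.
Proof. by apply: filterS inner_nsq => t E; rewrite mulcJ E. Qed.

Lemma inner_ebounded : ebounded theta.
Proof.
split; first by case: theta_inner => /H2_L2/L2_meas.
by exists 1; apply: filterS inner_nsq => t ->.
Qed.

Lemma modelperp_zn n : n < 0 -> modelperp theta (zn n).
Proof.
move=> n0; split=> [|y [_ Hy]]; first exact: L2_zn.
rewrite ipC//; [|exact: L2_zn|exact: H2_L2].
by rewrite [ip _ _]H2_neg// conjC0.
Qed.

Lemma modelperp_inner_zn n : 0 <= n -> modelperp theta (theta \* zn n).
Proof.
move=> n0; have b2 : L2 (theta \* zn n) by apply: L2M (L2_zn _ _); exact: inner_ebounded.
split=> // y /modelspaceP[Hy [h [Hh h0] yE]].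
have h2 := H2_L2 Hh.
rewrite (@ip_eq_integrand _ _ h (zn (- n)))//; [|exact: H2_L2|exact: L2_zn|].
  move: n0; rewrite le_eqVlt => /predU1P[<-|n0]; first exact: h0.
  by rewrite [ip _ _]H2_neg// oppr_lt0.
apply: filterS2 yE inner_mulcJ => t /= yE E.
rewrite /conjf yE /= rmorphM /= conjCK znN /= [X in _ = _ * X]conjCK.
by rewrite -[RHS]mul1r -E; ring.
Qed.

Lemma inner_modelperp h : H2 h -> forall y, modelspace theta y ->
  ip (theta \* h) y = 0.
Proof.
move=> Hh y /modelspaceP[Hy [k [Hk k0] yE]].
rewrite (@ip_eq_integrand _ _ h (conjf k)).
- exact: H2_ortho.
- by apply: L2M; [exact: inner_ebounded|exact: H2_L2].
- exact: H2_L2.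
- exact: H2_L2.
- exact/L2J/H2_L2.
apply: filterS2 yE inner_mulcJ => t /= yE E.
by rewrite /conjf yE /= rmorphM /= -[RHS]mul1r -E; ring.
Qed.

Variable g : R -> C.
Hypothesis g_bounded : ebounded g.

Local Notation N := (kerdualtto theta g).

(** Testing against the functions z^n with n < 0 and theta z^n with n >= 0,
    which are orthogonal to the model space, shows that a function orthogonal
    to modelperp theta lies in the model space. *)
Lemma kerP f : N f <-> modelperp theta f /\ modelspace theta (g \* f).
Proof.
have perp0 : modelperp theta (cst 0) by case: (linclosed_modelperp theta).
split=> [[perpf [_ gf0]]|[perpf msf]]; last first.
  split=> //; split=> // x [x2 xms].
  have f2 : L2 (g \* f) by apply: modelspace_L2 msf.
  rewrite (_ : g \* f \- cst 0 = g \* f); last first.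
    by apply/funext => t /=; rewrite subr0.
  by rewrite ipC// xms// conjC0.
split=> //; have f2 : L2 f by case: perpf.
have gf2 : L2 (g \* f) by exact: L2M.
have {}gf0 x : modelperp theta x -> ip (g \* f) x = 0.
  move=> /gf0; congr (ip _ _ = _); apply/funext => t /=; by rewrite subr0.
have th2 := ebounded_L2 inner_ebounded.
pose h := theta \* conjf (g \* f).
have h2 : L2 h by apply: L2M; [exact: inner_ebounded|exact: L2J].
have hn n : n <= 0 -> fourier h n = 0.
  move=> n0; rewrite /fourier.
  have b2 : L2 (theta \* zn (- n)) by apply: L2M (L2_zn _ _); exact: inner_ebounded.
  rewrite (@ip_eq_integrand _ _ (theta \* zn (- n)) (g \* f))//.
  - by rewrite ipC// gf0 ?conjC0//; apply: modelperp_inner_zn; rewrite oppr_ge0.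
  - exact: L2_zn.
  - apply: aeW => t; rewrite /h /= /conjf -/(zn _ _) znN; ring.
apply/modelspaceP; split.
  by apply: H2P => // n n0; rewrite [fourier _ _]gf0//; exact: modelperp_zn.
exists h; first by split; [apply: H2P => // n /ltW; exact: hn|exact: hn].
apply: filterS inner_mulcJ => t E; rewrite /h /conjf /= rmorphM /= [X in _ = _ * (_ * X)]conjCK.
by rewrite mulrA E mul1r.
Qed.

Lemma ker_L2 : N `<=` @L2 R.
Proof. by move=> f /kerP[[]]. Qed.

Lemma linclosed_ker : linclosed N.
Proof.
split=> [|a x y /kerP[px mx] /kerP[py my]]; apply/kerP; split.
- by case: (linclosed_modelperp theta).
- rewrite (_ : g \* cst 0 = cst 0); first by case: (linclosed_modelspace theta).
  by apply/funext => t /=; rewrite mulr0.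
- exact: (linclosed_modelperp theta).2.
- rewrite (_ : g \* _ = cst a \* (g \* x) \+ g \* y).
    exact: (linclosed_modelspace theta).2.
  by apply/funext => t /=; ring.
Qed.

Lemma aeclosed_ker : aeclosed N.
Proof.
move=> f f' mf' ff' /kerP[pf mf]; apply/kerP; split.
  exact: aeclosed_modelperp ff' pf.
apply: aeclosed_modelspace mf.
  by apply: cmeasurableM => //; case: g_bounded.
exact: aeqM (aeq_refl g) ff'.
Qed.

Lemma linclosed_C : linclosed (spaceC theta g).
Proof.
apply: linclosedI.
  apply: linclosedI; first exact: linclosed_ker.
  apply: linclosed_sumset; first exact: linclosed_conjH20.
  exact/linclosed_mulset/linclosed_H2.
split=> [|a x y [Nx gx] [Ny gy]]; split.
- by case: linclosed_ker.
- rewrite (_ : g \* cst 0 = cst 0); last first.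
    by apply/funext => t /=; rewrite mulr0.
  by case: (linclosedI (linclosed_modelspace theta) (linclosed_mulset (@zT R) (linclosed_H2 R))).
- exact: linclosed_ker.2.
- rewrite (_ : g \* _ = cst a \* (g \* x) \+ g \* y).
    exact: (linclosedI (linclosed_modelspace theta) (linclosed_mulset (@zT R) (linclosed_H2 R))).2.
  by apply/funext => t /=; ring.
Qed.

Lemma aeclosed_C : aeclosed (spaceC theta g).
Proof.
move=> f f' mf' ff' [[Nf [mf [x [y [Xx Yy /aeqP fE]]]]] [_ [gms [_ [k Hk /aeqP gE]]]]].
have Nf' := aeclosed_ker mf' ff' Nf.
have mgf' : cmeasurable (g \* f') by apply: cmeasurableM; case: g_bounded.
have gff : aeq (g \* f) (g \* f') := aeqM (aeq_refl g) ff'.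
split; first split=> //.
  split=> //; exists x, y; split=> //; apply/aeqP.
  by apply: aeq_trans fE; exact: aeq_sym.
split=> //; split; first exact: aeclosed_modelspace gff gms.
split=> //; exists k => //; apply/aeqP.
by apply: aeq_trans gE; exact: aeq_sym.
Qed.

Lemma C_sub_ker : spaceC theta g `<=` N.
Proof. by move=> f [[]]. Qed.

(** Near invariance. If f = conj h1 + theta z h2, then zbar f is
    conj (z h1) + theta h2, which is orthogonal to the model space; if
    g f = z k = theta conj h, then zbar g f is k = theta conj (z h), which is in
    the model space. *)
Lemma C_shift f : spaceC theta g f -> N (zn (-1) \* f).
Proof.
move=> [[Nf [mf [x [y [[h1 [Hh1 h10] <-] [_ [h2 Hh2 /aeqP yE]] /aeqP fE]]]]]].
move=> [_ [gms [_ [k Hk /aeqP gE]]]].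
have f2 := ker_L2 Nf.
have zf2 : L2 (zn (-1) \* f) by apply: L2M => //; exact: ebounded_zn.
have [Hz1 z10] := H2_zT Hh1.
have zz t : zn (-1) t * zT t = 1 :> C by rewrite -zn1 -znD zn0.
apply/kerP; split.
  split=> // v vms; have v2 := modelspace_L2 vms; have Hv : H2 v by case: vms.
  have c2 : L2 (conjf (@zT R \* h1)) by exact/L2J/H2_L2.
  have t2 : L2 (theta \* h2) by apply: L2M; [exact: inner_ebounded|exact: H2_L2].
  rewrite (@ip_aeq _ _ (conjf (@zT R \* h1) \+ theta \* h2) _ v)//.
  - by rewrite ipDl// inner_modelperp// addr0 ipC// H2_ortho// conjC0.
  - exact: L2D.
  - apply: filterS2 fE yE => t /= fE yE.
    rewrite fE /= yE /= mulrDr /conjf /= rmorphM /= znN zn1; congr (_ + _).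
    by rewrite -[RHS]mul1r -[in RHS](zz t) (znN 1) zn1; ring.
  - exact: aeq_refl.
have mgzf : cmeasurable (g \* (zn (-1) \* f)).
  by apply: cmeasurableM; [case: g_bounded|exact: L2_meas].
have kE : aeq k (g \* (zn (-1) \* f)).
  by apply: filterS gE => t /= E; rewrite mulrCA E /= mulrA zz mul1r.
move: gms => /modelspaceP[_ [h [Hh h0] hE]].
have [Hzh zh0] := H2_zT Hh.
apply/modelspaceP; split; first exact: aeclosed_H2 kE Hk.
exists (@zT R \* h) => //; apply: filterS hE => t /= E.
by rewrite mulrCA E /= /conjf /= rmorphM /= (znN 1) zn1 mulrCA.
Qed.

End DualTruncatedToeplitzKernel.

(** * Finite-dimensional subspaces of L^2 *)

Section FiniteDimension.
Variable R : realType.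
Local Notation C := R[i].
Local Notation mu := (arcm R).
Implicit Types (f g h : R -> C) (a b : C).

Lemma lincombD k (c d : 'rV[C]_k) (e : 'I_k -> R -> C) t :
  lincomb ((c + d) ord0) e t = lincomb (c ord0) e t + lincomb (d ord0) e t.
Proof.
by rewrite /lincomb -big_split; apply: eq_bigr => i _; rewrite mxE mulrDl.
Qed.

Lemma lincombZ k a (c : 'rV[C]_k) (e : 'I_k -> R -> C) t :
  lincomb ((a *: c) ord0) e t = a * lincomb (c ord0) e t.
Proof.
by rewrite /lincomb mulr_sumr; apply: eq_bigr => i _; rewrite mxE mulrA.
Qed.

Lemma lincombN k (c : 'rV[C]_k) (e : 'I_k -> R -> C) t :
  lincomb ((- c) ord0) e t = - lincomb (c ord0) e t.
Proof. by rewrite -scaleN1r lincombZ mulN1r. Qed.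

Lemma lincomb0 k (e : 'I_k -> R -> C) t : lincomb ((0 : 'rV[C]_k) ord0) e t = 0.
Proof. by rewrite /lincomb big1// => i _; rewrite mxE mul0r. Qed.

Lemma lincombM k l (c : 'rV[C]_k) (A : 'M[C]_(k, l)) (e : 'I_l -> R -> C) t :
  lincomb ((c *m A) ord0) e t = \sum_i c ord0 i * lincomb (A i) e t.
Proof.
rewrite /lincomb; under [LHS]eq_bigr do rewrite mxE mulr_suml.
rewrite exchange_big; apply: eq_bigr => i _; rewrite mulr_sumr.
by apply: eq_bigr => j _; rewrite mulrA.
Qed.

Lemma spanned_rV X k (e : 'I_k -> R -> C) : spanned X e ->
  forall x, X x -> exists c : 'rV[C]_k, aeq x (lincomb (c ord0) e).
Proof.
move=> [_ eX] x /eX[c /aeqP xE]; exists (\row_i c i).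
apply: filterS xE => t ->; apply: eq_bigr => i _; by rewrite mxE.
Qed.

Lemma lincomb_aeq k (c : 'I_k -> C) (e e' : 'I_k -> R -> C) :
  (forall i, aeq (e i) (e' i)) -> aeq (lincomb c e) (lincomb c e').
Proof.
move=> ee; rewrite /lincomb.
suff : forall r : seq 'I_k, aeq (fun t => \sum_(i <- r) c i * e i t)
  (fun t => \sum_(i <- r) c i * e' i t) by exact.
elim=> [|i r ih]; first by apply: aeW => t; rewrite !big_nil.
by apply: filterS2 (ee i) ih => t E F; rewrite !big_cons E F.
Qed.

(** The matrix has maximal rank among those whose rows satisfy S. *)
Lemma subspace_rows n (S : 'rV[C]_n -> Prop) :
  S 0 -> (forall a (x y : 'rV[C]_n), S x -> S y -> S (a *: x + y)) ->
  exists B : 'M[C]_n, (forall x, S x -> (x <= B)%MS) /\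
    forall x, (x <= B)%MS -> S x.
Proof.
move=> S0 Sl.
have SB (B : 'M[C]_n) : (forall i, S (row i B)) -> forall x, (x <= B)%MS -> S x.
  move=> Br x /submxP[D ->]; rewrite mulmx_sum_row.
  elim/big_ind : _ => [//|y z Sy Sz|i _].
    by have := Sl 1 y z Sy Sz; rewrite scale1r.
  by have := Sl (D 0 i) _ _ (Br i) S0; rewrite addr0.
suff H k (B : 'M[C]_n) : (forall x, (x <= B)%MS -> S x) -> (n - \rank B <= k)%N ->
   exists B : 'M[C]_n, (forall x, S x -> (x <= B)%MS) /\
    forall x, (x <= B)%MS -> S x.
  by apply: (H n 0) => [x|]; [rewrite submx0 => /eqP ->|exact: leq_subr].
elim: k B => [|k ih] B Bs rB.
  exists B; split=> // x _; apply: submx_full.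
  by rewrite /row_full eqn_leq rank_leq_col -subn_eq0 -leqn0.
have [[x Sx xB]|nx] := pselect (exists2 x, S x & ~~ (x <= B)%MS).
  apply: (ih (B + x)%MS).
    move=> y /sub_addsmxP[[D1 D2] ->] /=.
    have -> : D2 *m x = D2 0 0 *: x.
      by rewrite {1}[D2]mx11_scalar mul_scalar_mx.
    by rewrite addrC; apply: Sl => //; apply: Bs; exact: submxMl.
  have : (\rank B < \rank (B + x)%MS)%N.
    by apply: rank_ltmx; rewrite ltmxE addsmxSl addsmx_sub submx_refl (negbTE xB).
  by move: rB; lia.
exists B; split=> // x Sx; apply: contrapT => /negP xB; apply: nx; by exists x.
Qed.

Lemma sub_spanned X Y k (e : 'I_k -> R -> C) : spanned X e -> Y `<=` X ->
  linclosed Y -> aeclosed Y -> (forall x, X x -> cmeasurable x) ->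
  exists v : 'I_k -> R -> C, spanned Y v.
Proof.
move=> Xe YX lY aY Xm; have eX := Xe.1.
have [||B [YB BY]] := @subspace_rows k (fun c => Y (lincomb (c ord0) e)).
- rewrite (_ : lincomb _ _ = cst 0); first by case: lY.
  by apply/funext => t; rewrite lincomb0.
- move=> a c d Yc Yd; rewrite (_ : lincomb _ _ =
    cst a \* lincomb (c ord0) e \+ lincomb (d ord0) e); first exact: lY.2.
  by apply/funext => t; rewrite lincombD lincombZ.
exists (fun i => lincomb (row i B ord0) e); split.
  by move=> i; apply: BY; exact: row_sub.
move=> x Yx; have [c xc] := spanned_rV Xe (YX _ Yx).
have /submxP[D cE] : (c <= B)%MS.
  apply: YB; apply: aY xc Yx; apply: linclosed_lincomb => [|i].
    exact: linclosed_cmeas.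
  by apply/Xm/eX.
exists (D ord0); apply/aeqP; apply: aeq_trans xc _; rewrite cE.
apply: aeW => t; rewrite lincombM; apply: eq_bigr => i _; congr (_ * _).
by apply: eq_bigr => j _; rewrite mxE.
Qed.

Lemma gram_solve n (G : 'M[C]_n) (b : 'rV[C]_n) :
  (forall y : 'cV[C]_n, G *m y = 0 -> b *m y = 0) -> exists c, b = c *m G.
Proof.
move=> Gb; suff /submxP[c ->] : (b <= G)%MS by exists c.
rewrite submxE; apply/eqP/matrixP => i j.
have E : G *m (cokermx G *m delta_mx j (0 : 'I_1)) = 0.
  by rewrite mulmxA mulmx_coker mul0mx.
by have := Gb _ E; rewrite mulmxA -colE => /colP/(_ i); rewrite !mxE.
Qed.

(** Orthogonal projection on the span of finitely many vectors, for the
    direct sum of k copies of L^2: the Gram matrix of the vectors may be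
    singular, but a vector in its kernel gives a combination of norm 0. *)
Lemma projection k n (x : 'I_k -> R -> C) (e : 'I_n -> 'I_k -> R -> C) :
  (forall p, L2 (x p)) -> (forall i p, L2 (e i p)) ->
  exists c : 'rV[C]_n, forall i,
    \sum_p ip (x p \- lincomb (c ord0) (e ^~ p)) (e i p) = 0.
Proof.
move=> x2 e2.
pose G := \matrix_(i < n, j < n) \sum_p ip (e i p) (e j p).
pose b := \row_j \sum_p ip (x p) (e j p).
have [|c bE] := @gram_solve n G b; last first.
  exists c => i; have /rowP/(_ i) := bE; rewrite !mxE => E.
  under eq_bigr => p _.
    rewrite ipBl//; last exact: L2_lincomb.
    rewrite ip_lincombl//; over.
  rewrite sumrB E exchange_big /=; apply/eqP; rewrite subr_eq0; apply/eqP.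
  by apply: eq_bigr => j _; rewrite mxE mulr_sumr.
move=> y Gy; pose d i := (y i 0)^*.
pose w p := lincomb d (e ^~ p).
have w2 p : L2 (w p) by apply: L2_lincomb => i.
have ipw h p : L2 h -> ip h (w p) = \sum_j ip h (e j p) * y j 0.
  move=> h2; rewrite ipC// ip_lincombl// rmorph_sum /=.
  apply: eq_bigr => j _; rewrite rmorphM /= [X in X * _]conjCK -ipC// mulrC//.
have ww : \sum_p ip (w p) (w p) = 0.
  under eq_bigr => p _ do rewrite ip_lincombl//.
  rewrite exchange_big big1// => i _; rewrite -mulr_sumr.
  under eq_bigr => p _ do rewrite ipw//.
  rewrite exchange_big /=; have /colP/(_ i) := Gy; rewrite !mxE.
  have -> : \sum_j G i j * y j 0 = \sum_j \sum_p ip (e i p) (e j p) * y j 0.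
    by apply: eq_bigr => j _; rewrite mxE mulr_suml.
  by move=> ->; rewrite mulr0.
have w0 p : sqnorm (w p) = 0.
  have : \sum_p sqnorm (w p) = 0.
    by apply: complexI; rewrite rmorph_sum /=; apply: (etrans _ ww); apply: eq_bigr => q _; rewrite -ipff.
  move=> /eqP; rewrite psumr_eq0; last by move=> q _; exact: sqnorm_ge0.
  by move=> /allP/(_ p (mem_index_enum p))/eqP.
apply/colP => i; rewrite !mxE (ord1 i).
under eq_bigr do rewrite mxE mulr_suml.
rewrite exchange_big big1// => p _.
by rewrite -ipw// ip_small.
Qed.

End FiniteDimension.

Section ClosedSpan.
Variable R : realType.
Local Notation C := R[i].
Local Notation mu := (arcm R).

Lemma projection_min k n (x : 'I_k -> R -> C) (e : 'I_n -> 'I_k -> R -> C)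
    (c : 'rV[C]_n) : (forall p, L2 (x p)) -> (forall i p, L2 (e i p)) ->
  (forall i, \sum_p ip (x p \- lincomb (c ord0) (e ^~ p)) (e i p) = 0) ->
  forall b : 'rV[C]_n,
    \sum_p sqnorm (x p \- lincomb (c ord0) (e ^~ p)) <=
    \sum_p sqnorm (x p \- lincomb (b ord0) (e ^~ p)).
Proof.
move=> x2 e2 orth b.
pose d p := x p \- lincomb (c ord0) (e ^~ p).
pose w p := lincomb ((c - b) ord0) (e ^~ p).
have l2 (v : 'rV[C]_n) p : L2 (lincomb (v ord0) (e ^~ p)) by apply: L2_lincomb => i.
have d2 p : L2 (d p) by exact: L2B.
have dw : \sum_p ip (d p) (w p) = 0.
  rewrite (eq_bigr (fun p => \sum_i ((c - b) ord0 i)^* * ip (d p) (e i p))).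
    rewrite exchange_big big1// => i _; rewrite -mulr_sumr [X in _ * X]orth.
    by rewrite mulr0.
  move=> p _; rewrite ipC//; last exact: l2.
  rewrite /w ip_lincombl// rmorph_sum /=; apply: eq_bigr => i _.
  by rewrite rmorphM /= -ipC.
have E p : x p \- lincomb (b ord0) (e ^~ p) = d p \+ w p.
  apply/funext => t /=; by rewrite /d /w lincombD lincombN /= addrA subrK.
have w2 p : L2 (w p) by exact: l2.
have S p : (sqnorm (d p \+ w p))%:C = (sqnorm (d p))%:C + (sqnorm (w p))%:C +
    (ip (d p) (w p) + (ip (d p) (w p))^*).
  rewrite -!ipff (ipDl (d2 p) (w2 p) (L2D (d2 p) (w2 p))).
  rewrite (ipDr (d2 p) (w2 p) (d2 p)) (ipDr (d2 p) (w2 p) (w2 p)).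
  by rewrite (ipC (w2 p) (d2 p)); ring.
rewrite [X in _ <= X](_ : _ = \sum_p sqnorm (d p) + \sum_p sqnorm (w p)).
  by rewrite lerDl sumr_ge0// => p _; exact: sqnorm_ge0.
apply: complexI; rewrite rmorphD !rmorph_sum /=.
transitivity (\sum_p ((sqnorm (d p))%:C + (sqnorm (w p))%:C +
    (ip (d p) (w p) + (ip (d p) (w p))^*))).
  by apply: eq_bigr => p _; rewrite -S E.
have dwJ : \sum_p (ip (d p) (w p))^* = 0.
  by rewrite -rmorph_sum /=; apply/eqP; rewrite conjC_eq0 dw.
by rewrite !big_split /= dw dwJ !addr0.
Qed.

(** Finite-dimensional spaces are closed: the distance to the projection is at
    most the distance to any other element of the span. *)
Lemma span_closed k n (x : 'I_k -> R -> C) (e : 'I_n -> 'I_k -> R -> C) :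
  (forall p, L2 (x p)) -> (forall i p, L2 (e i p)) ->
  (forall d : R, 0 < d -> exists b : 'rV[C]_n,
     \sum_p sqnorm (x p \- lincomb (b ord0) (e ^~ p)) < d) ->
  exists c : 'rV[C]_n, forall p, aeq (x p) (lincomb (c ord0) (e ^~ p)).
Proof.
move=> x2 e2 near; have [c cE] := projection x2 e2; exists c.
have cmin := projection_min x2 e2 cE.
have l2 p : L2 (lincomb (c ord0) (e ^~ p)) by apply: L2_lincomb => i.
have s0 : \sum_p sqnorm (x p \- lincomb (c ord0) (e ^~ p)) = 0.
  apply/eqP; rewrite eq_le sumr_ge0 ?andbT; last by move=> p _; exact: sqnorm_ge0.
  rewrite leNgt; apply/negP => /near[b]; rewrite ltNge => /negP; apply.
  exact: cmin.
move=> p; have : sqnorm (x p \- lincomb (c ord0) (e ^~ p)) = 0.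
  move/eqP: s0; rewrite psumr_eq0; last by move=> q _; exact: sqnorm_ge0.
  by move=> /allP/(_ p (mem_index_enum p))/eqP.
move=> /sqnorm_eq0 -/(_ (L2B (x2 p) (l2 p))); apply: filterS => t /= /eqP.
by rewrite subr_eq0 => /eqP.
Qed.

End ClosedSpan.

(** * The backward shift on the kernel *)

Section KernelStructure.
Variable R : realType.
Local Notation C := R[i].
Local Notation mu := (arcm R).
Implicit Types (f h : R -> C) (a b : C).

Lemma mul_lincomb h k (c : 'I_k -> C) e :
  h \* lincomb c e = lincomb c (fun i => h \* e i).
Proof.
apply/funext => t; rewrite /= /lincomb mulr_sumr; apply: eq_bigr => i _ /=.
by rewrite mulrCA.
Qed.

Lemma exists_left_kernel p q (B : 'M[C]_(p, q)) : (q < p)%N ->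
  exists2 w : 'rV[C]_p, w != 0 & w *m B = 0.
Proof.
move=> qp; exists (nz_row (kermx B)).
  rewrite nz_row_eq0 kermx_eq0 /row_free; apply/negP => /eqP Bp.
  by have := rank_leq_col B; rewrite Bp leqNgt qp.
by apply/sub_kermxP; exact: nz_row_sub.
Qed.

Lemma sqnorm_lincomb k (c : 'I_k -> C) e : (forall i, L2 (e i)) ->
  (forall i j, ip (e i) (e j) = (i == j)%:R) ->
  sqnorm (lincomb c e) = \sum_i nsq (c i).
Proof.
move=> e2 eE; have l2 := L2_lincomb c e2; apply: complexI.
rewrite -ipff ip_lincombl// rmorph_sum /=; apply: eq_bigr => i _.
rewrite ipC// ip_lincombl// (bigD1 i)//= big1 => [|j ji].
  by rewrite eE eqxx mulr1 addr0 mulcJ.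
by rewrite eE (negbTE ji) mulr0.
Qed.

Lemma zT_inj (s t : R) : 0 < s < 2 * pi -> 0 < t < 2 * pi ->
  zT s = zT t :> C -> s = t.
Proof.
move=> sc tc [cst sst].
have := sin_circle sc; have := sin_circle tc; rewrite sst => -[+ _] [+ _].
move=> -> st.
have cosC (y : R) : cos (2 * pi - y) = cos y.
  by rewrite cosB mulr_natl cos2pi sin2pi mul0r mul1r addr0.
have crit (x y : R) : 0 < x < 2 * pi -> (x < pi) = (y < pi) -> sin x = sin y ->
    pi < x -> y <= pi -> False.
  move=> xc xy sxy px yp; have yE : y = pi.
    apply/eqP; rewrite eq_le yp /=; move: xy; rewrite ltNge (ltW px).
    by move=> /esym/negbT; rewrite -leNgt.
  by have := (sin_circle xc).2; rewrite px sxy yE sinpi oppr0 ltxx.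
case: (leP s pi) => sp; case: (leP t pi) => tp.
- by apply: cos_inj cst; rewrite in_itv/= ?sp ?tp andbT ltW//; [case/andP: sc|case/andP: tc].
- by case: (crit t s).
- by case: (crit s t).
- suff : 2 * pi - s = 2 * pi - t by lra.
  case/andP: sc => s0 s2; case/andP: tc => t0 t2.
  by apply: (@cos_inj R); rewrite ?in_itv/= ?cosC//; apply/andP; split; lra.
Qed.

Lemma ae_zT_neq (w : C) : \forall t \ae mu, zT t != w.
Proof.
have [[s sc sw]|nw] := pselect (exists2 s : R, 0 < s < 2 * pi & zT s = w).
  apply: filterS2 (ae_in_circle R) (ae_neq s) => t tc; apply: contra => /eqP tw.
  by apply/eqP; apply: zT_inj => //; rewrite tw sw.
apply: filterS (ae_in_circle R) => t tc; apply/eqP => tw; apply: nw.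
by exists t.
Qed.

Variables theta g : R -> C.
Hypothesis theta_inner : inner_function theta.
Hypothesis g_bounded : ebounded g.

Local Notation N := (kerdualtto theta g).
Local Notation D := (spaceC theta g).

Variables (n : nat) (e : 'I_n -> R -> C).
Hypothesis spanN : spanned N e.

Variables (m : nat) (u : 'I_m -> R -> C).
Hypothesis Nu : forall i, N (u i).
Hypothesis uD : forall i c, D c -> ip (g \* u i) (g \* c) = 0.
Hypothesis u_orth : forall i j, ip (g \* u i) (g \* u j) = (i == j)%:R.
Hypothesis dimND : hasdim (ominus N D) m.

Let N2 f : N f -> L2 f.
Proof. exact: (ker_L2 theta_inner g_bounded). Qed.

Let D2 f : D f -> L2 f.
Proof. by move=> /C_sub_ker/N2. Qed.

Let lN : linclosed N. Proof. exact: linclosed_ker. Qed.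
Let lD : linclosed D. Proof. exact: linclosed_C. Qed.

Lemma projection_C f : L2 f -> exists2 p, D p & forall y, D y -> ip (f \- p) y = 0.
Proof.
move=> f2.
have [v spv] : exists v : 'I_n -> R -> C, spanned D v.
  apply: (sub_spanned spanN _ lD).
  - exact: C_sub_ker.
  - exact: (aeclosed_C theta_inner g_bounded).
  - by move=> x /N2/L2_meas.
have v2 i : L2 (v i) by apply: D2; case: spv.
have [c cE] := @projection R 1 n (fun=> f) (fun i _ => v i) (fun=> f2) (fun i _ => v2 i).
have Dp : D (lincomb (c ord0) v) by apply: linclosed_lincomb => //; case: spv.
have p2 := D2 Dp; have fp2 := L2B f2 p2.
exists (lincomb (c ord0) v) => // y Dy.
have [d yE] := spanned_rV spv Dy; have y2 := D2 Dy.
have l2 := L2_lincomb (d ord0) v2.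
rewrite (ip_aeq fp2 y2 fp2 l2 (aeq_refl _) yE) ipC// ip_lincombl//.
rewrite big1 ?conjC0// => i _.
by have := cE i; rewrite big_ord1 => E; rewrite ipC// E conjC0 mulr0.
Qed.

(** The m + 1 components of f and of the u i orthogonal to D are linearly
    dependent; f cannot drop out of the relation, because the u i are
    independent modulo D. *)
Lemma ker_decomp f : N f ->
  exists (a : 'rV[C]_m) c, D c /\ aeq f (lincomb (a ord0) u \+ c).
Proof.
move=> Nf; have [d spd _] := dimND.
have u2 i := N2 (Nu i).
have res x : N x -> exists p (b : 'rV[C]_m),
    D p /\ aeq x (lincomb (b ord0) d \+ p).
  move=> Nx; have [p Dp xp] := projection_C (N2 Nx).
  have Np : N p by exact: C_sub_ker.
  have : ominus N D (x \- p).
    split=> //; rewrite (_ : x \- p = cst (-1) \* p \+ x); first exact: lN.2.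
    by apply/funext => t /=; rewrite mulN1r addrC.
  move=> /(spanned_rV spd)[b bE]; exists p, b; split=> //.
  by apply: filterS bE => t /= <-; rewrite subrK.
have [pf [bf [Dpf fE]]] := res f Nf.
have [pu /(_ _)/cid-/all_sig[bu puE]] := choice (fun i => res (u i) (Nu i)).
have Dpu i := (puE i).1; have {puE}uE i := (puE i).2.
pose A := \matrix_(i < m) bu i.
have [w w0 wE] := @exists_left_kernel (1 + m) m (col_mx bf A) (leqnn _).
rewrite -(hsubmxK w) in w0 wE; set w1 := lsubmx w in w0 wE; set w2 := rsubmx w in w0 wE.
rewrite mul_row_col in wE.
set s := w1 0 0; have w1E : w1 = s%:M by rewrite [LHS]mx11_scalar.
pose cc := cst s \* pf \+ lincomb (w2 ord0) pu.
have Dcc : D cc by apply: lD.2 => //; exact: linclosed_lincomb.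
have rel : aeq (cst s \* f \+ lincomb (w2 ord0) u) cc.
  have uE' := lincomb_aeq (w2 ord0) uE.
  apply: filterS2 fE uE' => t /= fE' ->; rewrite fE'.
  rewrite [X in _ + X](_ : _ = lincomb ((w2 *m A) ord0) d t + lincomb (w2 ord0) pu t); last first.
    rewrite lincombM /lincomb -big_split /=; apply: eq_bigr => i _.
    rewrite mulrDr; congr (_ * _ + _); apply: eq_bigr => j _.
    by rewrite mxE.
  rewrite mulrDr addrACA -lincombZ -lincombD.
  have -> : s *: bf + w2 *m A = 0 by rewrite -wE w1E mul_scalar_mx.
  by rewrite lincomb0 add0r.
have [s0|s0] := eqVneq s 0.
  exfalso; move/eqP: w0; apply.
  suff -> : w2 = 0 by rewrite w1E s0 raddf0 row_mx0.
  apply/rowP => j; rewrite [RHS]mxE -[LHS]/(w2 ord0 j).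
  have gu2 i : L2 (g \* u i) by exact: L2M.
  have gl2 : L2 (lincomb (w2 ord0) (fun i => g \* u i)) by exact: L2_lincomb.
  have gc2 : L2 (g \* cc) by apply: L2M => //; exact: D2.
  have E : ip (lincomb (w2 ord0) (fun i => g \* u i)) (g \* u j) = w2 ord0 j.
    rewrite ip_lincombl// (bigD1 j)//= big1 => [|i ij].
      by rewrite u_orth eqxx mulr1 addr0.
    by rewrite u_orth (negbTE ij) mulr0.
  rewrite -E (@ip_aeq _ _ (g \* cc) _ (g \* u j))//; last 2 first.
  - rewrite -mul_lincomb; apply: filterS rel => t /= <-.
    by rewrite s0 mul0r add0r.
  - exact: aeq_refl.
  by rewrite ipC// uD// conjC0.
exists (- s^-1 *: w2), (cst s^-1 \* cc); split; first exact: linclosedZ.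
apply: filterS rel => t /= <-.
by rewrite lincombZ mulrDr mulrA mulVf// mul1r mulNr addrCA addNr addr0.
Qed.

(** M is the matrix of f -> zbar c, where c is the component of f in D. *)
Lemma ker_system : exists (alpha : 'M[C]_(n, m)) (M : 'M[C]_n), forall i,
  aeq (e i) (lincomb (alpha i) u \+ @zT R \* lincomb (M i) e) /\
  exists2 c, D c & aeq c (@zT R \* lincomb (M i) e).
Proof.
suff H i : exists (am : 'rV[C]_m * 'rV[C]_n),
  aeq (e i) (lincomb (am.1 ord0) u \+ @zT R \* lincomb (am.2 ord0) e) /\
  exists2 c, D c & aeq c (@zT R \* lincomb (am.2 ord0) e).
  have [am amE] := choice H.
  exists (\matrix_i (am i).1), (\matrix_i (am i).2) => i.
  have rE k l (F : 'I_k -> 'rV[C]_l) (v : 'I_l -> R -> C) (j : 'I_k) :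
      lincomb ((\matrix_i F i) j) v = lincomb (F j ord0) v.
    by apply/funext => t; apply: eq_bigr => q _; rewrite mxE.
  by rewrite !rE; exact: amE.
have [a [c [Dc eE]]] := ker_decomp (spanN.1 i).
have [b bE] := spanned_rV spanN (C_shift theta_inner g_bounded Dc).
have cE : aeq c (@zT R \* lincomb (b ord0) e).
  apply: filterS bE => t /= <-.
  by rewrite mulrA -zn1 -znD zn0 mul1r.
exists (a, b); split; last by exists c.
by apply: filterS2 eE cE => t /= -> ->.
Qed.

End KernelStructure.

(** * The spectral bound *)

Section SpectralBound.
Variable R : realType.
Local Notation C := R[i].
Local Notation mu := (arcm R).
Implicit Types (f h : R -> C) (a b : C).
Variables (theta g : R -> C).
Hypothesis theta_inner : inner_function theta.
Hypothesis g_bounded : ebounded g.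

Local Notation N := (kerdualtto theta g).
Local Notation D := (spaceC theta g).

Variables (n : nat) (e : 'I_n -> R -> C).
Hypothesis spanN : spanned N e.
Hypothesis freee : forall c, lincomb c e = cst 0 %[ae mu] -> forall i, c i = 0.

Variables (m : nat) (u : 'I_m -> R -> C).
Hypothesis Nu : forall i, N (u i).
Hypothesis uD : forall i c, D c -> ip (g \* u i) (g \* c) = 0.
Hypothesis u_orth : forall i j, ip (g \* u i) (g \* u j) = (i == j)%:R.

Variables (alpha : 'M[C]_(n, m)) (M : 'M[C]_n).
Hypothesis sysE : forall i,
  aeq (e i) (lincomb (alpha i) u \+ @zT R \* lincomb (M i) e).
Hypothesis sysD : forall i, exists2 c, D c & aeq c (@zT R \* lincomb (M i) e).

(** An eigenvector gives f = sum_p a_p u_p + l z f with l z f in D, so that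
    ||g f||^2 = sum_p |a_p|^2 + |l|^2 ||g f||^2. If |l| >= 1, then the a_p
    vanish and f = l z f. *)
Lemma eigenvalue_lt1 (v : 'rV[C]_n) (l : C) :
  v != 0 -> v *m M = l *: v -> nsq l < 1.
Proof.
move=> v0 vM; rewrite ltNge; apply/negP => l1.
have N2 f : N f -> L2 f by exact: (ker_L2 theta_inner g_bounded).
have e2 i : L2 (e i) by apply/N2; case: spanN.
have u2 i : L2 (u i) by exact: N2.
pose f := lincomb (v ord0) e; pose a := v *m alpha.
have f2 : L2 f by exact: L2_lincomb.
have zf2 : L2 (@zT R \* f) by apply: L2M => //; exact: ebounded_zT.
have fE : aeq f (lincomb (a ord0) u \+ cst l \* (@zT R \* f)).
  apply: filterS (lincomb_aeq (v ord0) sysE) => t E; rewrite [f t]E.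
  rewrite /= /a lincombM mulrCA.
  have -> : l * f t = \sum_i v ord0 i * lincomb (M i) e t.
    by rewrite -lincombM vM lincombZ.
  rewrite mulr_sumr -big_split; apply: eq_bigr => i _ /=; ring.
have [c cD] := choice (fun i => let: ex_intro2 c Dc cE := sysD i in
  ex_intro (fun c => D c /\ aeq c (@zT R \* lincomb (M i) e)) c (conj Dc cE)).
have cE : aeq (lincomb (v ord0) c) (cst l \* (@zT R \* f)).
  apply: filterS (lincomb_aeq (v ord0) (fun i => (cD i).2)) => t ->.
  rewrite /= mulrCA; have -> : l * f t = \sum_i v ord0 i * lincomb (M i) e t.
    by rewrite -lincombM vM lincombZ.
  by rewrite mulr_sumr; apply: eq_bigr => i _ /=; ring.
have DC : D (lincomb (v ord0) c).
  apply: linclosed_lincomb; first exact: (linclosed_C theta_inner g_bounded).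
  by move=> i; case: (cD i).
set w := lincomb (v ord0) c in cE DC.
have w2 : L2 w by apply: N2; exact: C_sub_ker.
have gu2 i : L2 (g \* u i) by exact: L2M.
have gw2 : L2 (g \* w) by exact: L2M.
have gf2 : L2 (g \* f) by exact: L2M.
have gl2 : L2 (lincomb (a ord0) (fun i => g \* u i)) by exact: L2_lincomb.
have gfE : aeq (g \* f) (lincomb (a ord0) (fun i => g \* u i) \+ g \* w).
  rewrite -mul_lincomb; apply: filterS2 fE cE => t /= E ->.
  by rewrite -mulrDr -E.
have orth : ip (lincomb (a ord0) (fun i => g \* u i)) (g \* w) = 0.
  by rewrite ip_lincombl// big1// => i _; rewrite uD// mulr0.
have sf : sqnorm (g \* f) = \sum_i nsq (a ord0 i) + nsq l * sqnorm (g \* f).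
  rewrite {1}(sqnorm_aeq gf2 (L2D gl2 gw2) gfE) sqnormD// sqnorm_lincomb//.
  congr (_ + _).
  have zgf2 : L2 (@zT R \* (g \* f)) by apply: L2M => //; exact: ebounded_zT.
  rewrite (sqnorm_aeq gw2 (L2Z l zgf2)).
    rewrite sqnormZ//; congr (_ * _); rewrite !sqnormE; apply: eq_Rintegral => t _.
    by rewrite /= nsqM nsq_zT mul1r.
  by apply: filterS cE => t /= ->; ring.
have a0 i : a ord0 i = 0.
  have : \sum_i nsq (a ord0 i) = 0.
    apply/eqP; rewrite eq_le sumr_ge0 ?andbT; last by move=> j _; exact: nsq_ge0.
    have := sqnorm_ge0 (g \* f); nra.
  move=> /eqP; rewrite psumr_eq0; last by move=> j _; exact: nsq_ge0.
  by move=> /allP/(_ i (mem_index_enum i))/eqP/nsq_eq0.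
have l0 : l != 0.
  by apply/eqP => l0; move: l1; rewrite l0 nsq0 leNgt ltr01.
have f0 : aeq f (cst 0).
  apply: filterS2 fE (ae_zT_neq l^-1) => t /=.
  rewrite [lincomb _ u t]big1; last by move=> i _; rewrite a0 mul0r.
  rewrite add0r => fE zl; apply/eqP; apply: contraNT zl => ft0.
  apply/eqP; apply: (mulfI l0); rewrite divff//; apply: (mulIf ft0).
  by rewrite mul1r -mulrA -fE.
move/eqP: v0; apply; apply/rowP => i; rewrite [RHS]mxE.
by apply: (freee (c := v ord0)); exact/aeqP.
Qed.

End SpectralBound.

(** * Rational functions in the Hardy space *)

Section RationalHardy.
Variable R : realType.
Local Notation C := R[i].
Local Notation mu := (arcm R).
Implicit Types (f h : R -> C) (a b : C) (p q : {poly C}).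

Definition pT p : R -> C := fun t => p.[zT t].

Lemma H2_pT p f : H2 f -> H2 (pT p \* f).
Proof.
move=> Hf; elim/poly_ind : p => [|p c ih].
  rewrite (_ : pT 0 \* _ = cst 0); first by case: (linclosed_H2 R).
  by apply/funext => t; rewrite /pT /= horner0 mul0r.
rewrite (_ : pT _ \* _ = cst c \* f \+ (@zT R \* (pT p \* f))); last first.
  by apply/funext => t; rewrite /pT /= hornerMXaddC; ring.
by apply: (linclosed_H2 R).2 => //; case: (H2_zT ih).
Qed.

Lemma H2_cst a : H2 (cst a : R -> C).
Proof.
apply: H2P => [|n n0]; first exact: L2_cst.
by rewrite fourier_cst; case: eqP n0 => [->|] //; rewrite ?ltxx ?mulr0.
Qed.

(** The bound is |z - a| >= |a| - 1. *)
Lemma ebounded_inv a : 1 < nsq a -> ebounded (fun t => (zT t - a)^-1).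
Proof.
move=> a1; pose r := Num.sqrt (nsq a).
have r1 : 1 < r by rewrite -[1]sqrtr1 ltr_sqrt// (lt_trans _ a1).
have r2 : r ^+ 2 = nsq a by rewrite sqr_sqrtr ?nsq_ge0.
have lb t : (r - 1) ^+ 2 <= nsq (zT t - a).
  have cs : (cos t * complex.Re a + sin t * complex.Im a) ^+ 2 <= r ^+ 2.
    rewrite r2 /nsq; have := cos2Dsin2 t; move: (cos t) (sin t) => x y xy.
    have := sqr_ge0 (x * complex.Im a - y * complex.Re a); nra.
  have csr : cos t * complex.Re a + sin t * complex.Im a <= r.
    rewrite (le_trans (ler_norm _))// -[X in _ <= X]ger0_norm; last lra.
    by rewrite -ler_sqr ?nnegrE// !real_normK ?num_real.
  have -> : nsq (zT t - a) = 1 + r ^+ 2 -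
      2 * (cos t * complex.Re a + sin t * complex.Im a).
    have -> : nsq (zT t - a) = (cos t - complex.Re a) ^+ 2 + (sin t - complex.Im a) ^+ 2.
      by case: (a).
    by rewrite r2 /nsq; have := cos2Dsin2 t; lra.
  by rewrite !expr2; nra.
have d0 : 0 < (r - 1) ^+ 2 by rewrite exprn_gt0// subr_gt0.
have pos t : 0 < nsq (zT t - a) by apply: lt_le_trans (lb t).
have mz : cmeasurable (fun t => zT t - a).
  rewrite (_ : (fun t => _) = @zT R \+ cst (- a)).
    by apply: cmeasurableD; [exact: cmeasurable_zT|exact: cmeasurable_cst].
  by apply/funext => t.
have E t : (zT t - a)^-1 = (zT t - a)^* * ((nsq (zT t - a))^-1)%:C.
  have nz : zT t - a != 0.
    by apply/eqP => z0; have := pos t; rewrite z0 /nsq /= expr0n addr0 ltxx.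
  apply: (mulfI nz); rewrite divff// mulrA mulcJ -rmorphM divff ?rmorph1//.
  by rewrite gt_eqF.
split.
  rewrite (_ : (fun t => _) = conjf (fun t => zT t - a) \*
      rc (fun t => (nsq (zT t - a))^-1)); last exact/funext.
  apply: cmeasurableM; first exact: cmeasurable_conj.
  have nE t : nsq (zT t - a) = (cos t - complex.Re a) * (cos t - complex.Re a) +
      (sin t - complex.Im a) * (sin t - complex.Im a).
    by rewrite /nsq /zT; case: (a) => x y /=; rewrite !expr2.
  apply: cmeasurable_rc; under eq_fun do rewrite nE.
  apply: continuous_measurable_fun => t.
  apply: cvgV; first by rewrite -nE gt_eqF.
  have ccos : (cos x - complex.Re a) @[x --> t] --> cos t - complex.Re a.
    by apply: cvgB; [exact: continuous_cos|exact: cvg_cst].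
  have csin : (sin x - complex.Im a) @[x --> t] --> sin t - complex.Im a.
    by apply: cvgB; [exact: continuous_sin|exact: cvg_cst].
  by apply: cvgD; exact: cvgM.
exists (((r - 1) ^+ 2)^-1); apply: aeW => t.
have -> : nsq (zT t - a)^-1 = (nsq (zT t - a))^-1.
  have nz : zT t - a != 0.
    by apply/eqP => z0; have := pos t; rewrite z0 /nsq /= expr0n addr0 ltxx.
  apply: (mulfI (lt0r_neq0 (pos t))); rewrite -nsqM (divff nz) divff ?gt_eqF//.
  exact: nsq1.
by rewrite lef_pV2 ?posrE.
Qed.

(** The negative Fourier coefficients of f / (z - a) form a geometric
    sequence of ratio a, hence vanish, being bounded. *)
Lemma H2_div_linear a f : 1 < nsq a -> H2 f ->
  H2 (fun t => f t / (zT t - a)).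
Proof.
move=> a1 Hf; have f2 := H2_L2 Hf.
set h := fun t => f t / (zT t - a).
have h2 : L2 h.
  rewrite (_ : h = (fun t => (zT t - a)^-1) \* f); last first.
    by apply/funext => t; rewrite /h mulrC.
  exact: L2M (ebounded_inv a1) f2.
have zh2 : L2 (@zT R \* h) by apply: L2M => //; exact: ebounded_zT.
have nz t : zT t - a != 0.
  apply/eqP => /eqP; rewrite subr_eq0 => /eqP z0.
  by move: a1; rewrite -z0 nsq_zT ltxx.
have fE : f = @zT R \* h \+ cst (- a) \* h.
  by apply/funext => t; rewrite /h /= mulNr -mulrBl mulrC divfK.
have rec n : n < 0 -> fourier h (n - 1) = a * fourier h n.
  move=> n0; have := H2_neg Hf n0.
  rewrite {1}fE fourierD//; last exact: L2Z.
  by rewrite fourier_zT fourierZ// mulNr => /eqP; rewrite subr_eq0 => /eqP.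
have iter_rec n (k : nat) : n < 0 -> fourier h (n - k%:Z) = a ^+ k * fourier h n.
  move=> n0; elim: k => [|k ih]; first by rewrite subr0 mul1r.
  rewrite (_ : n - k.+1%:Z = n - k%:Z - 1); last by lia.
  by rewrite rec ?ih ?exprS ?mulrA//; lia.
apply: H2P => // n n0; apply: nsq_eq0; apply/eqP.
rewrite eq_le nsq_ge0 andbT leNgt; apply/negP => hn0.
have nsqX (k : nat) : nsq (a ^+ k) = nsq a ^+ k.
  elim: k => [|k ih]; first by rewrite /nsq /= expr1n expr0n addr0.
  by rewrite !exprS nsqM ih.
have b k : nsq a ^+ k * nsq (fourier h n) <= sqnorm h.
  by rewrite -nsqX -nsqM -iter_rec//; exact: nsq_fourier_le.
have berno k : 1 + (nsq a - 1) *+ k <= nsq a ^+ k.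
  elim: k => [|k ih]; first by rewrite mulr0n addr0.
  rewrite exprS mulrS; have : 0 <= (nsq a - 1) *+ k by apply: mulrn_wge0; lra.
  move: ih; set x := _ *+ k; set y := _ ^+ k => *; nra.
pose x := sqnorm h / ((nsq a - 1) * nsq (fourier h n)).
have d0 : 0 < (nsq a - 1) * nsq (fourier h n) by rewrite mulr_gt0// subr_gt0.
have x0 : 0 <= x by rewrite divr_ge0 ?sqnorm_ge0// ltW.
have := archi_boundP x0; set k := Num.bound x; rewrite ltr_pdivrMr// => kx.
suff : sqnorm h < sqnorm h by rewrite ltxx.
apply: lt_le_trans kx _; apply: le_trans (b k); rewrite mulrA ler_wpM2r ?(ltW hn0)//.
by apply: le_trans (berno k); rewrite mulr_natl lerDr ler01.
Qed.

Lemma H2_quot q f : q != 0 -> (forall x, root q x -> 1 < nsq x) -> H2 f ->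
  H2 (fun t => f t / q.[zT t]).
Proof.
move=> q0 qr Hf; have [rs qE] := closed_field_poly_normal q.
have c0 : lead_coef q != 0 by rewrite lead_coef_eq0.
have rsr x : x \in rs -> 1 < nsq x.
  by move=> xrs; apply: qr; rewrite qE rootZ// root_prod_XsubC.
rewrite (_ : (fun t => _) = cst (lead_coef q)^-1 \*
    (fun t => f t / (\prod_(z <- rs) ('X - z%:P)).[zT t])); last first.
  apply/funext => t /=; rewrite {1}qE hornerZ invfM mulrCA.
  by congr (_ * _).
apply: linclosedZ; first exact: linclosed_H2.
elim: rs {qE} rsr => [|x rs ih] rsr.
  rewrite (_ : (fun t => _) = f)//; apply/funext => t.
  by rewrite big_nil hornerC divr1.
rewrite (_ : (fun t => _) =
   (fun t => (f t / (\prod_(z <- rs) ('X - z%:P)).[zT t]) / (zT t - x))).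
  apply: H2_div_linear; first by apply: rsr; rewrite mem_head.
  by apply: ih => y yrs; apply: rsr; rewrite inE yrs orbT.
by apply/funext => t; rewrite big_cons hornerM hornerXsubC invfM mulrCA mulrC -mulrA.
Qed.

End RationalHardy.

(** * The transfer function *)

Section Realization.
Variable R : realType.
Local Notation C := R[i].
Local Notation mu := (arcm R).
Implicit Types (f h : R -> C) (a b : C).

Variables (n m : nat) (M : 'M[C]_n) (alpha : 'M[C]_(n, m)).

Definition respoly : 'M[{poly C}]_n := 1%:M - 'X *: map_mx polyC M.

Definition resdet : {poly C} := \det respoly.

Definition resnum : 'M[{poly C}]_(n, m) := \adj respoly *m map_mx polyC alpha.

(** The entries of (1 - z M)^-1 alpha, with the inverse expressed by the
    adjugate matrix so that they are visibly rational. *)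
Definition transfer (p : 'I_m) (i : 'I_n) : R -> C :=
  fun t => (resnum i p).[zT t] / resdet.[zT t].

Hypothesis eig_lt1 :
  forall (v : 'rV[C]_n) l, v != 0 -> v *m M = l *: v -> nsq l < 1.

Lemma horner_respoly x : map_mx (horner_eval x) respoly = 1%:M - x *: M.
Proof.
apply/matrixP => i j; rewrite !mxE /horner_eval hornerD hornerN hornerM hornerX hornerC.
by congr (_ - _); case: (i == j); rewrite ?hornerC.
Qed.

Lemma horner_resdet x : resdet.[x] = \det (1%:M - x *: M).
Proof.
by rewrite -horner_respoly det_map_mx.
Qed.

Lemma resdet_neq0 : resdet != 0.
Proof.
apply/eqP => q0; have := horner_resdet 0; rewrite q0 horner0 scale0r subr0 det1.
by move=> /eqP; rewrite eq_sym oner_eq0.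
Qed.

(** The roots of det (1 - x M) are the inverses of the nonzero eigenvalues of M. *)
Lemma resdet_root x : root resdet x -> 1 < nsq x.
Proof.
rewrite /root horner_resdet => /det0P[v v0].
rewrite mulmxBr mulmx1 -scalemxAr => /eqP; rewrite subr_eq0 => /eqP vE.
have x0 : x != 0 by apply: contraNneq v0 => x0; rewrite vE x0 scale0r.
have vM : v *m M = x^-1 *: v by rewrite [X in _ *: X]vE scalerA mulVf// scale1r.
have := eig_lt1 v0 vM; have : nsq x^-1 * nsq x = 1 by rewrite -nsqM mulVf// nsq1.
by have := nsq_ge0 x; have := nsq_ge0 x^-1; nra.
Qed.

Lemma resdet_zT t : resdet.[zT t] != 0.
Proof.
by apply/negP => /resdet_root; rewrite nsq_zT ltxx.
Qed.

Lemma H2_transfer p i : H2 (transfer p i).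
Proof.
apply: H2_quot; [exact: resdet_neq0|exact: resdet_root|].
have := H2_pT (resnum i p) (H2_cst 1); congr H2.
by apply/funext => t; rewrite /pT /= mulr1.
Qed.

Lemma L2_transfer p i : L2 (transfer p i).
Proof. exact/H2_L2/H2_transfer. Qed.

Lemma H2_transfer_lincomb p (c : 'rV[C]_n) :
  H2 (lincomb (c ord0) (transfer p)).
Proof.
by apply: linclosed_lincomb => [|j]; [exact: linclosed_H2|exact: H2_transfer].
Qed.

Lemma transferE p i t :
  transfer p i t = alpha i p + zT t * lincomb (M i) (transfer p) t.
Proof.
have entry (B : 'M[{poly C}]_(n, m)) (d : {poly C}) :
    respoly *m B = d *: map_mx polyC alpha ->
    B i p - 'X * \sum_j (M i j)%:P * B j p = d * (alpha i p)%:P.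
  rewrite /respoly mulmxBl mul1mx -scalemxAl => /matrixP/(_ i p).
  rewrite !mxE => <-; congr (_ - _ * _).
  by apply: eq_bigr => j _; rewrite mxE.
have /entry/(congr1 (horner^~ (zT t))) :
    respoly *m resnum = resdet *: map_mx polyC alpha.
  by rewrite /resnum mulmxA mul_mx_adj mul_scalar_mx.
rewrite hornerD hornerN !hornerM hornerX hornerC => /eqP.
rewrite subr_eq => /eqP E.
apply: (mulfI (resdet_zT t)); rewrite mulrDr {1}/transfer [LHS]mulrC divfK ?resdet_zT//.
rewrite E; congr (_ + _); rewrite mulrCA; congr (_ * _).
rewrite horner_sum /lincomb mulr_sumr; apply: eq_bigr => j _.
by rewrite hornerM hornerC mulrCA /transfer [resdet.[_] * _]mulrC divfK ?resdet_zT.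
Qed.

Lemma at0_transfer p i : at0 (transfer p i) = alpha i p.
Proof.
have l2 : H2 (lincomb (M i) (transfer p)).
  by apply: linclosed_lincomb => [|j]; [exact: linclosed_H2|exact: H2_transfer].
have [zl2 z0] := H2_zT l2.
rewrite (_ : transfer p i = cst (alpha i p) \+ (@zT R \* lincomb (M i) (transfer p))).
  rewrite /at0 fourierD ?[fourier (_ \* _) _]z0//; [|exact: L2_cst|exact: H2_L2].
  by rewrite fourier_cst mulr1 addr0.
by apply/funext => t; rewrite transferE.
Qed.

Lemma transfer_solve (e : 'I_n -> R -> C) (u : 'I_m -> R -> C) :
  (forall i, aeq (e i) (lincomb (alpha i) u \+ @zT R \* lincomb (M i) e)) ->
  forall i, aeq (e i) (fun t => \sum_p transfer p i t * u p t).
Proof.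
move=> eE; have : \forall t \ae mu, forall i,
    e i t = lincomb (alpha i) u t + zT t * lincomb (M i) e t.
  suff : forall r : seq 'I_n, \forall t \ae mu, forall i, i \in r ->
      e i t = lincomb (alpha i) u t + zT t * lincomb (M i) e t.
    move=> /(_ (index_enum _)); apply: filterS => t h i.
    by apply: h; exact: mem_index_enum.
  elim=> [|j r ih]; first by apply: aeW => t i.
  apply: filterS2 (eE j) ih => t E F i; rewrite inE => /predU1P[->|] //.
  exact: F.
move=> all_e i; apply: filterS all_e => t {}eE.
pose ec : 'cV[C]_n := \col_i e i t; pose uc : 'cV[C]_m := \col_p u p t.
pose T : 'M[C]_(n, m) := \matrix_(i, p) transfer p i t.
pose A := 1%:M - zT t *: M.
have Au : A \in unitmx by rewrite unitmxE unitfE -horner_resdet resdet_zT.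
have Ae : A *m ec = alpha *m uc.
  rewrite mulmxBl mul1mx -scalemxAl; apply/colP => j; rewrite !mxE eE.
  rewrite -addrA [X in _ + X](_ : _ = 0) ?addr0.
    by apply: eq_bigr => p _; rewrite mxE.
  apply/eqP; rewrite subr_eq0; apply/eqP; congr (_ * _).
  by apply: eq_bigr => k _; rewrite mxE.
have AT : A *m T = alpha.
  rewrite mulmxBl mul1mx -scalemxAl; apply/matrixP => j p; rewrite !mxE transferE.
  rewrite -addrA [X in _ + X](_ : _ = 0) ?addr0//.
  apply/eqP; rewrite subr_eq0; apply/eqP; congr (_ * _).
  by apply: eq_bigr => k _; rewrite mxE.
have : ec = T *m uc.
  by rewrite -[LHS](mulKmx Au) Ae -AT -mulmxA mulKmx.
move=> /colP/(_ i); rewrite !mxE => ->.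
by apply: eq_bigr => p _; rewrite !mxE.
Qed.

Lemma transfer_lincomb (e : 'I_n -> R -> C) (u : 'I_m -> R -> C) (c : 'rV[C]_n) :
  (forall i, aeq (e i) (lincomb (alpha i) u \+ @zT R \* lincomb (M i) e)) ->
  aeq (lincomb (c ord0) e)
    (fun t => \sum_p u p t * lincomb (c ord0) (transfer p) t).
Proof.
move=> /transfer_solve/(lincomb_aeq (c ord0)); apply: filterS => t ->.
rewrite /lincomb; under eq_bigr do rewrite mulr_sumr.
rewrite exchange_big; apply: eq_bigr => p _; rewrite mulr_sumr.
by apply: eq_bigr => i _; rewrite mulrA mulrC.
Qed.

End Realization.

(** * The invariant space of pairs *)

Section TwoDimensional.
Variable R : realType.
Local Notation C := R[i].
Local Notation mu := (arcm R).

Variables (n : nat) (M : 'M[C]_n) (alpha : 'M[C]_(n, 2)).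
Hypothesis eig_lt1 :
  forall (v : 'rV[C]_n) l, v != 0 -> v *m M = l *: v -> nsq l < 1.

Definition pair_fun (x : (R -> C) * (R -> C)) (p : 'I_2) : R -> C :=
  if p == ord0 then x.1 else x.2.

Definition transfer_space : set ((R -> C) * (R -> C)) :=
  [set x | (forall p, cmeasurable (pair_fun x p)) /\
    exists c : 'rV[C]_n, forall p,
      aeq (pair_fun x p) (lincomb (c ord0) (transfer M alpha p))].

Lemma ord2 (p : 'I_2) : p = ord0 \/ p = lift ord0 ord0.
Proof. by case: p => [[|[|//]] ip]; [left|right]; exact/val_inj. Qed.

Lemma transfer_space_H2 x : transfer_space x -> forall p, H2 (pair_fun x p).
Proof.
move=> [mx [c xE]] p; apply: aeclosed_H2 (mx p) (aeq_sym (xE p)) _.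
exact: H2_transfer_lincomb.
Qed.

(** Closedness comes from finite dimension, and invariance from the equation
    k = alpha + z M k, in which alpha is the value of k at 0. *)
Lemma transfer_space_invariant : closed_bshift_invariant transfer_space.
Proof.
have L2t p (i : 'I_n) : L2 (transfer M alpha p i) by exact: L2_transfer.
split.
- by move=> x /transfer_space_H2 Hx; split; [exact: (Hx ord0)|exact: (Hx (lift ord0 ord0))].
- split.
    split; first by move=> p; rewrite /pair_fun; case: ifP => _; exact: cmeasurable_cst.
    exists 0 => p; apply: aeW => t; rewrite lincomb0 /pair_fun.
    by case: ifP.
  move=> a x y [mx [c xE]] [my [d yE]].
  have pE p : pair_fun (cst a \* x.1 \+ y.1, cst a \* x.2 \+ y.2) p =
      cst a \* pair_fun x p \+ pair_fun y p.
    by rewrite /pair_fun; case: ifP.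
  split; first by move=> p; rewrite pE; exact: (linclosed_cmeas R).2.
  exists (a *: c + d) => p; rewrite pE; apply: filterS2 (xE p) (yE p) => t /= -> ->.
  by rewrite lincombD lincombZ.
- move=> x [x1 x2] near.
  have Hx p : H2 (pair_fun x p) by rewrite /pair_fun; case: ifP.
  split; first by move=> p; exact/L2_meas/H2_L2.
  apply: (@span_closed _ _ _ (pair_fun x) (fun i p => transfer M alpha p i)) => //.
    by move=> p; exact: H2_L2.
  move=> d /near[y [my [b yE]] yd]; exists b.
  rewrite (eq_bigr (fun p => sqnorm (pair_fun x p \- pair_fun y p))).
    by rewrite big_ord_recl big_ord1.
  have Hy p : H2 (pair_fun y p) by apply: transfer_space_H2; split=> //; exists b.
  move=> p _; have x2' := H2_L2 (Hx p); have y2' := H2_L2 (Hy p).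
  have l2 : L2 (lincomb (b ord0) (transfer M alpha p)) by exact: L2_lincomb.
  apply: sqnorm_aeq; [exact: L2B|exact: L2B|].
  by apply: filterS (yE p) => t /= ->.
- move=> x Kx; have Hx := transfer_space_H2 Kx; case: Kx => mx [c xE].
  have pE p : pair_fun (bshift x.1, bshift x.2) p =
      zn (-1) \* (pair_fun x p \- cst (at0 (pair_fun x p))).
    by rewrite /pair_fun; case: ifP => _; apply/funext => t;
      rewrite /bshift /= (znN 1) zn1 zTJ mulrC.
  split.
    move=> p; rewrite pE; apply: cmeasurableM; first exact: cmeasurable_zn.
    by apply: L2_meas; apply: L2B; [exact: H2_L2|exact: L2_cst].
  exists (c *m M) => p; rewrite pE.
  have aE : at0 (pair_fun x p) = \sum_i c ord0 i * alpha i p.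
    rewrite /at0 (fourier_aeq _ _ _ (xE p)); [|exact: H2_L2|exact: L2_lincomb].
    rewrite fourier_lincomb//; apply: eq_bigr => i _; congr (_ * _).
    exact: at0_transfer.
  apply: filterS (xE p) => t /= ->; rewrite aE lincombM.
  have -> : lincomb (c ord0) (transfer M alpha p) t = \sum_i c ord0 i * alpha i p +
     zT t * \sum_i c ord0 i * lincomb (M i) (transfer M alpha p) t.
    rewrite mulr_sumr -big_split; apply: eq_bigr => i _ /=.
    by rewrite [transfer M alpha p i t]transferE//; ring.
  rewrite addrC addKr (znN 1) zn1 zTJ mulKf//; exact: zT_neq0.
Qed.

End TwoDimensional.

(** * Model spaces of rational functions *)

Section OneDimensional.
Variable R : realType.
Local Notation C := R[i].
Local Notation mu := (arcm R).
Implicit Types (f h x y : R -> C) (a b : C) (p q : {poly C}).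

Lemma ae_horner_neq0 p : p != 0 -> \forall t \ae mu, p.[zT t] != 0.
Proof.
move=> p0; have [rs pE] := closed_field_poly_normal p.
have c0 : lead_coef p != 0 by rewrite lead_coef_eq0.
suff H (s : seq C) : \forall t \ae mu,
    (lead_coef p *: \prod_(z <- s) ('X - z%:P)).[zT t] != 0.
  by apply: filterS (H rs) => t; rewrite -pE.
elim: s => [|x s ih].
  by apply: aeW => t; rewrite big_nil hornerZ hornerC mulr1.
apply: filterS2 ih (ae_zT_neq x) => t.
rewrite big_cons !hornerZ hornerM hornerXsubC !mulf_eq0 (negbTE c0) /= => h zx.
by rewrite negb_or h subr_eq0 zx.
Qed.

Lemma size_signM (b : bool) p : size ((-1) ^+ b * p) = size p.
Proof. by case: b; rewrite ?expr0 ?expr1 ?mul1r// mulN1r size_polyN. Qed.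

Lemma size_det_leq k (A : 'M[{poly C}]_k) :
  (forall i j, (size (A i j) <= 2)%N) -> (size (\det A) <= k.+1)%N.
Proof.
move=> A2; rewrite /determinant; apply: (leq_trans (size_sum _ _ _)).
apply/bigmax_leqP => s _.
rewrite size_signM; apply: (leq_trans (size_poly_prod_leq _ _)); rewrite card_ord leq_subLR.
apply: (@leq_ltn_trans (\sum_(i < k) 2)%N); first exact: leq_sum.
by rewrite sum_nat_const card_ord; lia.
Qed.

Lemma size_adj_leq k (A : 'M[{poly C}]_k.+1) i j :
  (forall i j, (size (A i j) <= 2)%N) -> (size (\adj A i j) <= k.+1)%N.
Proof.
move=> A2; rewrite mxE /cofactor -signr_odd.
rewrite size_signM; by apply: size_det_leq => a b; rewrite !mxE.
Qed.

Lemma size_resnum k m (M : 'M[C]_k.+1) (alpha : 'M[C]_(k.+1, m)) i j :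
  (size (resnum M alpha i j) <= k.+1)%N.
Proof.
rewrite mxE; apply: (leq_trans (size_sum _ _ _)); apply/bigmax_leqP => l _.
rewrite [(map_mx _ _) l j]mxE mulrC mul_polyC; apply: (leq_trans (size_scale_leq _ _)).
apply: size_adj_leq => a b; rewrite !mxE.
apply: (leq_trans (size_polyD _ _)); rewrite geq_max size_polyN; apply/andP; split.
  by case: (a == b); rewrite ?size_poly1 ?size_poly0.
apply: (leq_trans (size_polyMleq _ _)); rewrite size_polyX.
by move: (size_polyC_leq1 (M a b)); case: (size _) => [|[]].
Qed.

(** The polynomial that takes the values z^k conj (p z) on the circle, for p of
    degree at most k. *)
Definition revc k p : {poly C} := \poly_(i < k.+1) (p`_(k - i))^*.

Lemma horner_revc k p t : (size p <= k.+1)%N ->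
  (revc k p).[zT t] = zT t ^+ k * (p.[zT t])^*.
Proof.
move=> pk; rewrite (horner_coef_wide _ pk) rmorph_sum mulr_sumr /revc horner_poly.
rewrite (reindex_inj rev_ord_inj) /=; apply: eq_bigr => i _.
have ik : (i <= k)%N by rewrite -ltnS.
rewrite subSS subKn// rmorphM mulrCA; congr (_ * _).
have E : zT t ^+ k = zT t ^+ (k - i) * zT t ^+ i :> C by rewrite -exprD subnK.
rewrite E rmorphXn /= zTJ -mulrA -exprMn divff ?zT_neq0//.
by rewrite expr1n mulr1.
Qed.

Lemma H20_pT p h : H20 h -> H20 (pT p \* h).
Proof.
move=> Hh; elim/poly_ind : p => [|p c ih].
  rewrite (_ : pT 0 \* _ = cst 0); first by case: (linclosed_H20 R).
  by apply/funext => t; rewrite /pT /= horner0 mul0r.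
rewrite (_ : pT _ \* _ = cst c \* h \+ (@zT R \* (pT p \* h))); last first.
  by apply/funext => t; rewrite /pT /= hornerMXaddC; ring.
apply: (linclosed_H20 R).2 => //; apply: H2_zT; by case: ih.
Qed.

Lemma H2_poly k x : H2 x -> (forall n : int, k%:Z <= n -> fourier x n = 0) ->
  exists2 p : {poly C}, (size p <= k)%N & aeq x (pT p).
Proof.
move=> Hx xk; have x2 := H2_L2 Hx.
exists (\poly_(i < k) fourier x i%:Z); first exact: size_poly.
pose w := lincomb (fun i : 'I_k => fourier x i%:Z) (fun i => zn i%:Z).
have w2 : L2 w by apply: L2_lincomb => i; exact: L2_zn.
have wE : w = pT (\poly_(i < k) fourier x i%:Z).
  by apply/funext => t; rewrite /pT horner_poly /w /lincomb; apply: eq_bigr.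
rewrite -wE; have : aeq (x \- w) (cst 0).
  apply: fourier_inj; first exact: L2B.
  move=> n; rewrite fourierB// fourier_lincomb; last by move=> i; exact: L2_zn.
  under eq_bigr do rewrite fourier_zn.
  have [n0|n0] := ltP n 0.
    rewrite H2_neg// big1 ?subr0// => i _; case: eqP => [E|]; last by rewrite mulr0.
    by move: n0; rewrite -E.
  have [kn|kn] := leP k%:Z n.
    rewrite xk// big1 ?subr0// => i _; case: eqP => [E|]; last by rewrite mulr0.
    by have := ltn_ord i; move: kn; rewrite -E; lia.
  case: n n0 kn => // n _ nk; have {}nk : (n < k)%N by lia.
  rewrite (bigD1 (Ordinal nk))//= eqxx mulr1 big1 ?addr0 ?subrr// => i.
  rewrite -val_eqE /= => ni; case: eqP => [[E]|]; last by rewrite mulr0.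
  by rewrite E eqxx in ni.
by apply: filterS => t /= /eqP; rewrite subr_eq0 => /eqP.
Qed.

(** On the circle chi = z^k conj q / q. A function x of the model space is
    z chi conj h with h in H^2_0, so q x = z^(k+1) conj (q h) has Fourier
    coefficients of indices 0 to k only. Conversely p / q = z chi conj h, where
    h = z (z^k conj p) / q. *)
Lemma modelspace_rational k q : (size q <= k.+1)%N -> q != 0 ->
  (forall z : C, root q z -> 1 < nsq z) ->
  let chi := fun t : R => (revc k q).[zT t] / q.[zT t] in
  inner_function chi /\ forall x, modelspace (chi \* @zT R) x <->
    (cmeasurable x /\ exists2 p : {poly C}, (size p <= k.+1)%N &
       aeq x (fun t => p.[zT t] / q.[zT t])).
Proof.
move=> qk q0 qr chi.
have qz t : q.[zT t] != 0 by apply/negP => /qr; rewrite nsq_zT ltxx.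
have zk t : zT t ^+ k != 0 :> C by rewrite expf_neq0// zT_neq0.
have Hpq p : H2 (fun t => p.[zT t] / q.[zT t]).
  apply: H2_quot => //; have := H2_pT p (H2_cst 1); congr H2.
  by apply/funext => t; rewrite /pT /= mulr1.
have chiE t : chi t = zT t ^+ k * (q.[zT t])^* / q.[zT t].
  by rewrite /chi horner_revc.
split.
  split; first exact: Hpq.
  apply/aeqP; apply: aeW => t; rewrite /= chiE.
  rewrite normrM normfV normrM norm_conjC normrX.
  have -> : `|zT t : C| = 1.
    by apply/eqP; rewrite -sqrp_eq1// -nsq_norm nsq_zT.
  by rewrite expr1n mul1r divff// normr_eq0.
move=> x; split=> [/modelspaceP[Hx [h Hh xE]]|[mx [p pk xE]]].
  split; first exact/L2_meas/H2_L2.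
  have Hqx : H2 (pT q \* x) by exact: H2_pT.
  have [Hqh qh0] := H20_pT q Hh.
  have qh2 := H2_L2 Hqh.
  have E : aeq (pT q \* x) (zn k.+1%:Z \* conjf (pT q \* h)).
    apply: filterS xE => t /= ->; rewrite chiE /pT /conjf /= rmorphM.
    by rewrite /zn -exprnP exprSr /=; field; exact: qz.
  have zq2 : L2 (zn k.+1%:Z \* conjf (pT q \* h)).
    by apply: L2M; [exact: ebounded_zn|exact: L2J].
  have [n nk|p pk pE] := @H2_poly k.+1 _ Hqx.
    rewrite (fourier_aeq _ (H2_L2 Hqx) zq2 E) fourier_shift fourierJ//.
    have [->|nk1] := eqVneq n k.+1%:Z.
      by rewrite subrr oppr0 [fourier _ _]qh0 conjC0.
    by rewrite H2_neg ?conjC0//; lia.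
  exists p => //; apply: filterS pE => t /= E1.
  by apply: (mulfI (qz t)); rewrite [RHS]mulrC divfK.
apply/modelspaceP; split.
  by apply: aeclosed_H2 (Hpq p) => //; exact: aeq_sym.
exists (@zT R \* (fun t => (revc k p).[zT t] / q.[zT t])).
  exact: H2_zT.
apply: filterS xE => t -> /=; rewrite chiE /conjf /= !horner_revc//.
rewrite !rmorphM /= fmorphV /= zTJ rmorphXn /= zTJ [(_ ^*)^*]conjCK.
have qJ : (q.[zT t])^* != 0 by rewrite conjC_eq0.
have z0 := zT_neq0 t; have zi : (zT t)^-1 ^+ k = (zT t ^+ k)^-1 by rewrite exprVn.
rewrite zi; field.
by rewrite qz qJ z0 zk.
Qed.

End OneDimensional.

(** * The theorem *)

Section Assembly.
Variable R : realType.
Local Notation C := R[i].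
Local Notation mu := (arcm R).
Variables theta g : R -> C.
Hypothesis theta_inner : inner_function theta.
Hypothesis g_bounded : ebounded g.
Local Notation N := (kerdualtto theta g).
Local Notation D := (spaceC theta g).

Variables (n : nat) (e : 'I_n -> R -> C).
Hypothesis spanN : spanned N e.
Hypothesis freee : forall c, lincomb c e = cst 0 %[ae mu] -> forall i, c i = 0.

Lemma ominus_mulset_C u : ominus (mulset g N) (mulset g D) (g \* u) ->
  forall c, D c -> ip (g \* u) (g \* c) = 0.
Proof.
move=> [_ gu] c Dc; apply: gu; split.
  apply: cmeasurableM; first by case: g_bounded.
  exact/L2_meas/(ker_L2 theta_inner g_bounded)/C_sub_ker.
by exists c => //; apply/aeqP; exact: aeq_refl.
Qed.

Lemma kernel_transfer m (u : 'I_m -> R -> C) : (forall i, N (u i)) ->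
  (forall i, ominus (mulset g N) (mulset g D) (g \* u i)) ->
  (forall i j, ip (g \* u i) (g \* u j) = (i == j)%:R) ->
  hasdim (ominus N D) m ->
  exists (alpha : 'M[C]_(n, m)) (M : 'M[C]_n),
    (forall (v : 'rV[C]_n) l, v != 0 -> v *m M = l *: v -> nsq l < 1) /\
    forall c : 'rV[C]_n, aeq (lincomb (c ord0) e)
      (fun t => \sum_p u p t * lincomb (c ord0) (transfer M alpha p) t).
Proof.
move=> Nu gu u_orth dimND; have uD i := ominus_mulset_C (gu i).
have [alpha [M sys]] := ker_system theta_inner g_bounded spanN Nu uD u_orth dimND.
have eig (v : 'rV[C]_n) l : v != 0 -> v *m M = l *: v -> nsq l < 1.
  apply: (eigenvalue_lt1 theta_inner g_bounded spanN freee Nu uD u_orth (alpha := alpha)) => i.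
  - by case: (sys i).
  - by case: (sys i).
exists alpha, M; split=> // c; apply: transfer_lincomb => // i.
by case: (sys i).
Qed.

Lemma ker_two (f0 h0 : R -> C) : N f0 -> N h0 ->
  orthonormal_basis (ominus (mulset g N) (mulset g D))
    (tnth [tuple g \* f0; g \* h0]) ->
  hasdim (ominus N D) 2 ->
  exists2 K : set ((R -> C) * (R -> C)), closed_bshift_invariant K &
    N = [set f | cmeasurable f /\
      exists2 k, K k & f = (f0 \* k.1) \+ (h0 \* k.2) %[ae mu]].
Proof.
move=> Nf0 Nh0 [[gu _] g_orth] dimND.
pose u := tnth [tuple f0; h0].
have guE i : g \* u i = tnth [tuple g \* f0; g \* h0] i.
  by case: (ord2 i) => ->; rewrite /u !(tnth_nth (cst 0)).
have Nu i : N (u i) by case: (ord2 i) => ->; rewrite /u !(tnth_nth (cst 0)).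
have ugu i : ominus (mulset g N) (mulset g D) (g \* u i) by rewrite guE.
have uorth i j : ip (g \* u i) (g \* u j) = (i == j)%:R by rewrite !guE.
have [alpha [M [eig tr]]] := kernel_transfer Nu ugu uorth dimND.
exists (transfer_space M alpha); first exact: transfer_space_invariant.
have u0 : u ord0 = f0 by rewrite /u (tnth_nth (cst 0)).
have u1 : u (lift ord0 ord0) = h0 by rewrite /u (tnth_nth (cst 0)).
apply/seteqP; split=> [f Nf|f [mf [k [mk [c kE]] /aeqP fE]]].
- have mf : cmeasurable f by exact/L2_meas/(ker_L2 theta_inner g_bounded).
  split=> //; have [c fE] := spanned_rV spanN Nf.
  exists (lincomb (c ord0) (transfer M alpha ord0),
      lincomb (c ord0) (transfer M alpha (lift ord0 ord0))).
    split.
      by move=> p; rewrite /pair_fun; case: ifP => _ /=; exact/L2_meas/H2_L2/H2_transfer_lincomb.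
    exists c => p; rewrite /pair_fun; case: (ord2 p) => -> /=; exact: aeq_refl.
  apply/aeqP; apply: aeq_trans fE (aeq_trans (tr c) _); apply: aeW => t.
  by rewrite big_ord_recl big_ord1 u0 u1.
- apply: (aeclosed_ker theta_inner g_bounded mf (f := lincomb (c ord0) e)).
    apply: aeq_trans (tr c) _; apply: aeq_sym.
    have := kE ord0; have := kE (lift ord0 ord0).
    rewrite /pair_fun /=; move: fE; apply: filterS3 => t /= -> E1 E0.
    by rewrite big_ord_recl big_ord1 u0 u1 -E1 -E0.
  apply: linclosed_lincomb; first exact: linclosed_ker.
  by case: spanN.
Qed.

Lemma ker_one (f0 : R -> C) : N f0 ->
  ominus (mulset g N) (mulset g D) (g \* f0) -> sqnorm (g \* f0) = 1 ->
  hasdim (ominus N D) 1 ->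
  exists2 chi : R -> C, inner_function chi &
    N = mulset f0 (modelspace (chi \* @zT R)).
Proof.
move=> Nf0 gf0 norm1 dimND.
have f02 : L2 f0 by exact: (ker_L2 theta_inner g_bounded).
have nz : ~ aeq f0 (cst 0).
  move=> f00; have := oner_neq0 R; rewrite -norm1 sqnorm0 ?eqxx//.
    by apply: filterS f00 => t /= ->; rewrite mulr0.
  exact: L2M.
have orth (i j : 'I_1) : ip (g \* f0) (g \* f0) = (i == j)%:R.
  by rewrite !ord1 eqxx ipff norm1.
have [alpha [M [eig tr]]] := kernel_transfer (fun=> Nf0) (fun=> gf0) orth dimND.
have {}tr (c : 'rV[C]_n) : aeq (lincomb (c ord0) e)
    (fun t => f0 t * lincomb (c ord0) (transfer M alpha ord0) t).
  by apply: filterS (tr c) => t ->; rewrite big_ord1.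
have [c0 f0E] := spanned_rV spanN Nf0.
move: e spanN freee M alpha eig tr c0 f0E; case: n => [|k] e' span' free' M alpha eig tr c0 f0E.
  case: nz; apply: filterS f0E => t ->; by rewrite /lincomb big_ord0.
have q0 := resdet_neq0 M; have qz := resdet_zT eig.
pose P (c : 'rV[C]_k.+1) := \sum_i c ord0 i *: resnum M alpha i ord0.
have PE (c : 'rV[C]_k.+1) t : lincomb (c ord0) (transfer M alpha ord0) t =
    (P c).[zT t] / (resdet M).[zT t].
  rewrite /P horner_sum mulr_suml; apply: eq_bigr => i _.
  by rewrite hornerZ /transfer mulrA.
have szP c : (size (P c) <= k.+1)%N.
  apply: (leq_trans (size_sum _ _ _)); apply/bigmax_leqP => i _.
  by apply: (leq_trans (size_scale_leq _ _)); exact: size_resnum.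
(* f0 is one of the combinations, so that the denominator is a numerator *)
have Pc0 : P c0 = resdet M.
  apply/eqP; rewrite -subr_eq0; apply/negPn/negP => d0; apply: nz.
  apply: filterS3 f0E (tr c0) (ae_horner_neq0 d0) => t E1 E2 dt.
  apply: (mulIf dt); rewrite mul0r hornerD hornerN mulrBr; apply/eqP.
  by rewrite subr_eq0 {2}E1 E2 PE mulrA divfK.
(* every numerator of the allowed degree occurs, by a dimension count *)
pose B := \matrix_(i < k.+1, j < k.+1) (resnum M alpha i ord0)`_j.
have PB (c : 'rV[C]_k.+1) (j : 'I_k.+1) : (P c)`_j = (c *m B) 0 j.
  by rewrite /P coef_sum mxE; apply: eq_bigr => i _; rewrite coefZ !mxE.
have Bu : B \in unitmx.
  rewrite -row_free_unit; apply: inj_row_free => c cB.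
  have Pc : P c = 0.
    apply/polyP => j; rewrite coef0; have [jk|jk] := ltnP j k.+1.
      by rewrite (PB c (Ordinal jk)) cB mxE.
    by rewrite nth_default// (leq_trans (szP c)).
  apply/rowP => i; rewrite [RHS]mxE; apply: (free' (c ord0)).
  by apply/aeqP; apply: filterS (tr c) => t ->; rewrite PE Pc horner0 mul0r mulr0.
have P_onto (p : {poly C}) : (size p <= k.+1)%N -> exists c, P c = p.
  move=> pk; exists ((\row_j p`_j) *m invmx B); apply/polyP => j.
  have [jk|jk] := ltnP j k.+1.
    by rewrite (PB _ (Ordinal jk)) mulmxKV// mxE.
  have z (r : {poly C}) : (size r <= k.+1)%N -> r`_j = 0.
    by move=> rk; apply: nth_default; exact: leq_trans rk jk.
  by rewrite !z.
have szq : (size (resdet M) <= k.+1)%N by rewrite -Pc0.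
have [chi_inner chiP] := modelspace_rational szq q0 (resdet_root eig).
exists (fun t => (revc k (resdet M)).[zT t] / (resdet M).[zT t]) => //.
apply/seteqP; split=> [f Nf|f [mf [x /chiP[mx [p pk xE]] /aeqP fE]]].
- have f2 : L2 f by exact: (ker_L2 theta_inner g_bounded).
  split; first exact: L2_meas.
  have [c fE] := spanned_rV span' Nf.
  exists (lincomb (c ord0) (transfer M alpha ord0)).
    apply/chiP; split; first exact/L2_meas/H2_L2/H2_transfer_lincomb.
    by exists (P c) => //; apply: aeW => t; rewrite PE.
  by apply/aeqP; exact: aeq_trans fE (tr c).
- have [c cE] := P_onto p pk.
  apply: (aeclosed_ker theta_inner g_bounded mf (f := lincomb (c ord0) e')).
    apply: aeq_trans (tr c) _; apply: filterS2 fE xE => t /= -> ->.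
    by rewrite PE cE.
  apply: linclosed_lincomb; first exact: linclosed_ker.
  by case: span'.
Qed.

End Assembly.

Theorem corollary6p4 (R : realType) (theta g : R -> R[i])
    (theta_inner : inner_function theta) (g_bounded : Linfty g)
    (ker_finite : finitedim (kerdualtto theta g)) :
  (hasdim (ominus (kerdualtto theta g) (spaceC theta g)) 2 ->
   forall f0 h0 : R -> R[i],
     kerdualtto theta g f0 -> kerdualtto theta g h0 ->
     orthonormal_basis
       (ominus (mulset g (kerdualtto theta g)) (mulset g (spaceC theta g)))
       (tnth [tuple g \* f0; g \* h0]) ->
   exists2 K : set ((R -> R[i]) * (R -> R[i])), closed_bshift_invariant K &
     kerdualtto theta g =
       [set f | cmeasurable f /\
          exists2 k, K k & f = (f0 \* k.1) \+ (h0 \* k.2) %[ae (arcm R)]])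
  /\
  (hasdim (ominus (kerdualtto theta g) (spaceC theta g)) 1 ->
   forall f0 : R -> R[i],
     kerdualtto theta g f0 ->
     ominus (mulset g (kerdualtto theta g)) (mulset g (spaceC theta g))
       (g \* f0) ->
     sqnorm (g \* f0) = 1 ->
   exists2 chi : R -> R[i], inner_function chi &
     kerdualtto theta g = mulset f0 (modelspace (chi \* @zT R))).
Proof.
have bg := Linfty_ebounded g_bounded.
have [n [e spanN freee]] := ker_finite.
split=> [dimND f0 h0 Nf0 Nh0 basis|dimND f0 Nf0 gf0 norm1].
- exact: (ker_two theta_inner bg spanN freee).
- exact: (ker_one theta_inner bg spanN freee).
Qed.
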